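(* Consider the two-dimensional isothermal Euler–Poisson system for $(t,\vec x)$, $\vec x=(x,y)\in\mathbb R^2$: \[ \rho_t+\nabla\cdot(\rho\vec u)=0,\qquad \rho\big(\vec u_t+(\vec u\cdot\nabla)\vec u\big)+\nabla P=-\rho\nabla\Phi,\qquad \Delta\Phi=2\pi\rho,\qquad P=K\rho, \] with a constant $K>0$. Let $\xi\neq 0$, $\lambda$, $a_0>0$, $a_1$ and $\alpha$ be arbitrary real constants. Let $a(t)$ be the solution of \[ \ddot a(t)=-\frac{\lambda}{a(t)}+\frac{\xi^2}{a(t)^3},\qquad a(0)=a_0,\ \dot a(0)=a_1, \] and let $f(s)$, $s\ge 0$, be the solution of \[ \ddot f(s)+\frac{1}{s}\dot f(s)+\frac{2\pi}{K}e^{f(s)}=\frac{2\lambda}{K},\qquad f(0)=\alpha,\ \dot f(0)=0, \] which exists on all of $[0,\infty)$. With $r=\sqrt{x^2+y^2}$ define \[ \rho(t,\vec x)=\frac{1}{a(t)^2}e^{f(r/a(t))},\qquad u_1=\frac{\dot a(t)}{a(t)}x-\frac{\xi}{a(t)^2}y,\qquad u_2=\frac{\xi}{a(t)^2}x+\frac{\dot a(t)}{a(t)}y, \] and let $\Phi$ be the radial potential with $\Phi_r(t,r)=\frac{2\pi}{r}\int_0^r\rho(t,\eta)\,\eta\,d\eta$. Then $a(t)$ exists and stays positive for all $t\ge 0$, and $(\rho,\vec u,\Phi)$ is a classical solution of the system for all $t\ge0$ (a global solution with rotation). Moreover: (I) if $\lambda>0$: (a) the solution is non-trivially (non-constantly)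 time-periodic, except in the case $a_0=|\xi|/\sqrt{\lambda}$ and $a_1=0$; (b) if $a_0=|\xi|/\sqrt{\lambda}$ and $a_1=0$, the solution is steady (independent of time); (II) if $\lambda\le 0$, the solution is global in time.
   Context: The solution $f$ of the singular ODE is understood as the solution of $(s\dot f)'=s\big(\tfrac{2\lambda}{K}-\tfrac{2\pi}{K}e^{f}\big)$ with $f(0)=\alpha$, $\dot f(0)=0$. For radially symmetric density, the Poisson equation $\Delta\Phi=2\pi\rho$ is taken in the radial form $\Phi_{rr}+\frac1r\Phi_r=2\pi\rho$, i.e. $\Phi_r=\frac{2\pi}{r}\int_0^r\rho(t,\eta)\eta\,d\eta$, and $\nabla\Phi=\frac{\vec x}{r}\Phi_r$. *)

(* Defs.v *)
From Stdlib Require Import Reals Lra Classical ClassicalEpsilon.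
Open Scope R_scope.

Definition F3 := R -> R -> R -> R.

Definition has_pt (g : F3) (t x y l : R) : Prop := derivable_pt_lim (fun s => g s x y) t l.
Definition has_px (g : F3) (t x y l : R) : Prop := derivable_pt_lim (fun s => g t s y) x l.
Definition has_py (g : F3) (t x y l : R) : Prop := derivable_pt_lim (fun s => g t x s) y l.

(* The partial derivative as a function: the (unique) limit if it exists, 0 otherwise. *)
Definition choose_lim (P : R -> Prop) : R :=
  match excluded_middle_informative (exists l, P l) with
  | left H => proj1_sig (constructive_indefinite_description _ H)
  | right _ => 0
  end.
Definition Dt (g : F3) : F3 := fun t x y => choose_lim (has_pt g t x y).
Definition Dx (g : F3) : F3 := fun t x y => choose_lim (has_px g t x y).
Definition Dy (g : F3) : F3 := fun t x y => choose_lim (has_py g t x y).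

Definition cont_on_half (g : F3) : Prop :=
  forall t x y, 0 <= t -> forall eps, 0 < eps -> exists delta, 0 < delta /\
    forall t' x' y', 0 <= t' -> Rabs (t' - t) < delta -> Rabs (x' - x) < delta ->
      Rabs (y' - y) < delta -> Rabs (g t' x' y' - g t x y) < eps.

Definition C1_half (g : F3) : Prop :=
  (forall t x y, 0 <= t ->
     (exists l, has_pt g t x y l) /\ (exists l, has_px g t x y l) /\
     (exists l, has_py g t x y l)) /\
  cont_on_half g /\ cont_on_half (Dt g) /\ cont_on_half (Dx g) /\ cont_on_half (Dy g).

(* Riemann integral of f over [a,b] (0 if f is not Riemann integrable). *)
Definition RInt (f : R -> R) (a b : R) : R :=
  match excluded_middle_informative (inhabited (Riemann_integrable f a b)) with
  | left H => RiemannInt (epsilon H (fun _ => True))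
  | right _ => 0
  end.

(* Classical solution, for t >= 0, of the 2D isothermal Euler-Poisson system
     rho_t + div(rho u) = 0,
     rho (u_t + (u.grad) u) + grad P = - rho grad Phi,   P = K rho,
     Delta Phi = 2 pi rho,
   where the potential enters only through its gradient G = grad Phi = (G1, G2)
   and Delta Phi = div G. *)
Definition EP_classical_solution (K : R) (rho u1 u2 G1 G2 : F3) : Prop :=
  C1_half rho /\ C1_half u1 /\ C1_half u2 /\ C1_half G1 /\ C1_half G2 /\
  C1_half (fun t x y => rho t x y * u1 t x y) /\
  C1_half (fun t x y => rho t x y * u2 t x y) /\
  forall t x y, 0 <= t ->
    Dt rho t x y + Dx (fun t x y => rho t x y * u1 t x y) t x y
                 + Dy (fun t x y => rho t x y * u2 t x y) t x y = 0 /\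
    rho t x y * (Dt u1 t x y + u1 t x y * Dx u1 t x y + u2 t x y * Dy u1 t x y)
      + Dx (fun t x y => K * rho t x y) t x y = - rho t x y * G1 t x y /\
    rho t x y * (Dt u2 t x y + u1 t x y * Dx u2 t x y + u2 t x y * Dy u2 t x y)
      + Dy (fun t x y => K * rho t x y) t x y = - rho t x y * G2 t x y /\
    Dx G1 t x y + Dy G2 t x y = 2 * PI * rho t x y.

Definition rad (x y : R) : R := sqrt (x ^ 2 + y ^ 2).
Definition rho_rad (f a : R -> R) (t r : R) : R := exp (f (r / a t)) / (a t) ^ 2.
Definition rho_of (f a : R -> R) : F3 := fun t x y => rho_rad f a t (rad x y).
Definition u1_of (xi : R) (a da : R -> R) : F3 :=
  fun t x y => da t / a t * x - xi / (a t) ^ 2 * y.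
Definition u2_of (xi : R) (a da : R -> R) : F3 :=
  fun t x y => xi / (a t) ^ 2 * x + da t / a t * y.
Definition Phir_of (f a : R -> R) (t r : R) : R :=
  2 * PI / r * RInt (fun eta => rho_rad f a t eta * eta) 0 r.
(* grad Phi = (x/r, y/r) Phi_r, set to 0 at the origin *)
Definition G1_of (f a : R -> R) : F3 := fun t x y =>
  if Req_EM_T (rad x y) 0 then 0 else x / rad x y * Phir_of f a t (rad x y).
Definition G2_of (f a : R -> R) : F3 := fun t x y =>
  if Req_EM_T (rad x y) 0 then 0 else y / rad x y * Phir_of f a t (rad x y).

(* Main.v *)
Require Import Defs.
From Stdlib Require Import Reals Lra Lia Classical FunctionalExtensionality.
From Coquelicot Require Import Coquelicot.
Open Scope R_scope.

(** In the variable z = (r/a)^2 everything becomes smooth up to the origin: with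
    A(z) = (1/z) int_0^z e^F, the profile equation has the first integral
    2 K F'(z) + pi A(z) = lambda, where F(s^2) = f(s), and grad Phi = pi A(z) (x, y) / a^2.
    The momentum equation then reduces to the equation for a, and the other two to
    identities.

    Replacing the force by its value at m for a < m makes it globally Lipschitz, so
    Picard iteration gives a global solution; if the potential at m exceeds the energy,
    this solution never reaches m and hence solves the original equation.  For lambda > 0
    the energy also bounds a from above, which forces arbitrarily late turning points; by
    uniqueness a is symmetric about each of them, and two reflections compose to a period. *)

(** The obstacle is one-sidedness: the partial derivatives at t = 0 and at the spatial origin are
    two-sided limits, while the profile equation holds only for s > 0 and says nothing of the second
    derivative of f at 0. Both ingredients are therefore extended to the whole line. The scale
    factor is solved for all real t, which also makes time reflections available. F is built on all
    of R as an antiderivative of the derivative that the first integral prescribes, with [sqrt z] =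
    0 for z < 0 supplying continuous data there. The fields are then C^1 on all of R^3. *)

(** * Elementary calculus on the real line *)

Lemma is_derive_continuous (f : R -> R) (x l : R) :
  is_derive f x l -> continuous f x.
Proof.
  intros H. apply (ex_derive_continuous (K := R_AbsRing) (V := R_NormedModule)).
  now exists l.
Qed.

Lemma is_derive_continuity_pt (f : R -> R) (x l : R) :
  is_derive f x l -> continuity_pt f x.
Proof.
  intros H. apply continuity_pt_filterlim. exact (is_derive_continuous _ _ _ H).
Qed.

Lemma continuous_eps (f : R -> R) (x : R) :
  continuous f x <-> (forall e, 0 < e -> exists d, 0 < d /\
    forall y, Rabs (y - x) < d -> Rabs (f y - f x) < e).
Proof.
  split.
  - intros H e He.
    destruct (proj1 (filterlim_locally (F := locally x) _ _) H (mkposreal e He)) as [d Hd].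
    exists d. split; [apply cond_pos|]. exact Hd.
  - intros H. apply filterlim_locally. intros [e He]. destruct (H e He) as [d [Hd P]].
    exists (mkposreal d Hd). exact P.
Qed.

Lemma is_derive_RInt_continuous (h : R -> R) (a t : R) :
  (forall x, continuous h x) -> is_derive (RInt h a) t (h t).
Proof.
  intros ch. apply (is_derive_RInt h (RInt h a) a t); auto.
  exists (mkposreal 1 Rlt_0_1). intros b _.
  apply (@RInt_correct R_CompleteNormedModule). apply ex_RInt_continuous. auto.
Qed.

Lemma RInt_point_0 (h : R -> R) (a : R) : RInt h a a = 0.
Proof. exact (RInt_point a h). Qed.

Lemma MVT_le (f df : R -> R) (a b : R) :
  a <= b -> (forall x, a <= x <= b -> is_derive f x (df x)) ->
  exists c, a <= c <= b /\ f b - f a = df c * (b - a).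
Proof.
  intros ab H.
  destruct (MVT_gen f a b df) as [c [Hc E]].
  - intros x Hx. rewrite Rmin_left, Rmax_right in Hx by lra. apply H. lra.
  - intros x Hx. rewrite Rmin_left, Rmax_right in Hx by lra.
    apply is_derive_continuity_pt with (df x). apply H. lra.
  - rewrite Rmin_left, Rmax_right in Hc by lra. exists c. auto.
Qed.

Lemma derive_nonneg_le (f df : R -> R) (a b : R) :
  a <= b -> (forall x, a <= x <= b -> is_derive f x (df x)) ->
  (forall x, a <= x <= b -> 0 <= df x) -> f a <= f b.
Proof.
  intros ab H P. destruct (MVT_le f df a b ab H) as [c [Hc E]].
  specialize (P c Hc). nra.
Qed.

Lemma derive_zero_const (f : R -> R) (a b : R) :
  (forall x, Rmin a b <= x <= Rmax a b -> is_derive f x 0) -> f a = f b.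
Proof.
  intros H. destruct (MVT_gen f a b (fun _ => 0)) as [c [_ E]].
  - intros x Hx. apply H. lra.
  - intros x Hx. apply is_derive_continuity_pt with 0. now apply H.
  - lra.
Qed.

(** The derivative is nondecreasing and vanishes at 0, so [h] falls before 0 and rises after it.
    This replaces integrating twice on each side of 0. *)
Lemma convex_critical_min (h dh d2h : R -> R) :
  (forall t, is_derive h t (dh t)) -> (forall t, is_derive dh t (d2h t)) ->
  (forall t, 0 <= d2h t) -> dh 0 = 0 -> forall t, h 0 <= h t.
Proof.
  intros H1 H2 P Z t. destruct (Rle_dec 0 t) as [p | p].
  - apply derive_nonneg_le with dh; auto. intros x Hx. rewrite <- Z.
    apply derive_nonneg_le with d2h; auto; lra.
  - enough (- h t <= - h 0) by lra.
    apply (derive_nonneg_le (fun s => - h s) (fun s => - dh s) t 0); [lra | |].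
    + intros x _. apply (is_derive_opp (V := R_NormedModule) h x (dh x)). auto.
    + intros x Hx. assert (dh x <= dh 0); [|lra].
      apply derive_nonneg_le with d2h; auto; lra.
Qed.

(** * Second-order equations with a globally Lipschitz force *)

(* The weight exp(kt) + exp(-kt) is an eigenfunction of the second derivative with
   eigenvalue k^2, so for k^2 = 2L the Picard map halves the weighted sup norm on
   the whole line. *)
Definition weight (k t : R) : R := exp (k * t) + exp (- (k * t)).

Lemma weight_pos (k t : R) : 0 < weight k t.
Proof. unfold weight. generalize (exp_pos (k * t)) (exp_pos (- (k * t))). lra. Qed.

Lemma weight_ge_1 (k t : R) : 1 <= weight k t.
Proof.
  unfold weight. generalize (exp_ineq1_le (k * t)) (exp_ineq1_le (- (k * t))). lra.
Qed.

Lemma weight_ge_abs (k t : R) : Rabs (k * t) <= weight k t.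
Proof.
  unfold weight.
  generalize (exp_ineq1_le (k * t)) (exp_ineq1_le (- (k * t)))
    (exp_pos (k * t)) (exp_pos (- (k * t))).
  intros. apply Rabs_le. lra.
Qed.

Lemma is_derive_weight (k t : R) :
  is_derive (weight k) t (k * (exp (k * t) - exp (- (k * t)))).
Proof. unfold weight. auto_derive; auto. ring. Qed.

(** Since k^2 = 2L, the second derivative of D/2 * weight is exactly the assumed bound on |d2|.
    Hence D/2 * weight minus or plus [d] is convex with slope 0 at 0, and its least value, attained
    there, is nonnegative. *)
Lemma weight_comparison (L k D : R) (d dd d2 : R -> R) :
  k * k = 2 * L -> 0 <= D ->
  (forall t, is_derive d t (dd t)) -> (forall t, is_derive dd t (d2 t)) ->
  d 0 = 0 -> dd 0 = 0 ->
  (forall t, Rabs (d2 t) <= L * (D * weight k t)) ->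
  forall t, Rabs (d t) <= D / 2 * weight k t.
Proof.
  intros kL D0 H1 H2 Z1 Z2 B t.
  assert (W2 : forall s, is_derive (fun s => k * (exp (k * s) - exp (- (k * s)))) s
                 (2 * L * weight k s)).
  { intros s. unfold weight. auto_derive; auto. rewrite <- kL. ring. }
  assert (Hs : forall sg, sg = 1 \/ sg = -1 -> sg * d t <= D / 2 * weight k t).
  { intros sg Hsg.
    assert (C : D / 2 * weight k 0 - sg * d 0 <= D / 2 * weight k t - sg * d t).
    { apply (convex_critical_min (fun s => D / 2 * weight k s - sg * d s)
        (fun s => D / 2 * (k * (exp (k * s) - exp (- (k * s)))) - sg * dd s)
        (fun s => D / 2 * (2 * L * weight k s) - sg * d2 s)).
      - intros s. apply (is_derive_minus (V := R_NormedModule)).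
        + apply is_derive_scal. apply is_derive_weight.
        + apply is_derive_scal. apply H1.
      - intros s. apply (is_derive_minus (V := R_NormedModule)).
        + apply (is_derive_scal (fun s => k * (exp (k * s) - exp (- (k * s))))). apply W2.
        + apply is_derive_scal. apply H2.
      - intros s. specialize (B s). apply Rabs_le_between in B.
        destruct Hsg; subst; lra.
      - rewrite Z2, Rmult_0_r, Ropp_0. ring. }
    rewrite Z1 in C. generalize (weight_pos k 0). nra. }
  apply Rabs_le. generalize (Hs 1 (or_introl eq_refl)) (Hs (-1) (or_intror eq_refl)). lra.
Qed.

(** The equation y'' = G(y) integrated twice, so that the iteration concerns one scalar function
    instead of a first-order system in the plane. *)
Definition picard_map (G : R -> R) (a0 a1 : R) (y : R -> R) (t : R) : R :=
  a0 + a1 * t + RInt (RInt (fun s => G (y s)) 0) 0 t.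

Fixpoint picard_iter (G : R -> R) (a0 a1 : R) (n : nat) : R -> R :=
  match n with
  | O => fun t => a0 + a1 * t
  | S m => picard_map G a0 a1 (picard_iter G a0 a1 m)
  end.

Definition lipschitz (L : R) (G : R -> R) : Prop :=
  forall u v, Rabs (G u - G v) <= L * Rabs (u - v).

Lemma lipschitz_continuous (L : R) (G : R -> R) (x : R) :
  0 < L -> lipschitz L G -> continuous G x.
Proof.
  intros L0 H. apply continuous_eps. intros e He.
  exists (e / L). split; [apply Rdiv_lt_0_compat; lra|]. intros y Hy.
  apply Rle_lt_trans with (1 := H y x).
  apply Rlt_le_trans with (L * (e / L)).
  - now apply Rmult_lt_compat_l.
  - right. field. lra.
Qed.

Lemma picard_map_derive (G : R -> R) (L a0 a1 : R) (y : R -> R) :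
  0 < L -> lipschitz L G -> (forall t, continuous y t) ->
  (forall t, is_derive (picard_map G a0 a1 y) t (a1 + RInt (fun s => G (y s)) 0 t)) /\
  (forall t, is_derive (fun t => a1 + RInt (fun s => G (y s)) 0 t) t (G (y t))).
Proof.
  intros L0 HL cy.
  assert (cG : forall t, continuous (fun s => G (y s)) t).
  { intros t. apply continuous_comp; auto. now apply lipschitz_continuous with L. }
  assert (d1 : forall t, is_derive (RInt (fun s => G (y s)) 0) t (G (y t))).
  { intros t. now apply (is_derive_RInt_continuous (fun s => G (y s))). }
  split; intros t.
  - unfold picard_map. apply (is_derive_plus (V := R_NormedModule)).
    + auto_derive; auto. ring.
    + apply is_derive_RInt_continuous. intros s. eapply is_derive_continuous. apply d1.
  - replace (G (y t)) with (0 + G (y t)) by ring.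
    apply (is_derive_plus (V := R_NormedModule)); [|apply d1].
    apply (is_derive_const (V := R_NormedModule)).
Qed.

Lemma picard_map_contract (G : R -> R) (L k D a0 a1 : R) (y z : R -> R) :
  0 < L -> k * k = 2 * L -> 0 <= D -> lipschitz L G ->
  (forall t, continuous y t) -> (forall t, continuous z t) ->
  (forall t, Rabs (y t - z t) <= D * weight k t) ->
  forall t, Rabs (picard_map G a0 a1 y t - picard_map G a0 a1 z t) <= D / 2 * weight k t.
Proof.
  intros L0 kL D0 HL cy cz B.
  destruct (picard_map_derive G L a0 a1 y L0 HL cy) as [y1 y2].
  destruct (picard_map_derive G L a0 a1 z L0 HL cz) as [z1 z2].
  apply (weight_comparison L k D _
    (fun t => a1 + RInt (fun s => G (y s)) 0 t - (a1 + RInt (fun s => G (z s)) 0 t))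
    (fun t => G (y t) - G (z t)) kL D0).
  - intros t. apply (is_derive_minus (V := R_NormedModule)); auto.
  - intros t. apply (is_derive_minus (V := R_NormedModule)); auto.
  - unfold picard_map. rewrite !RInt_point_0. ring.
  - rewrite !RInt_point_0. ring.
  - intros t. apply Rle_trans with (1 := HL (y t) (z t)).
    apply Rmult_le_compat_l; [lra | apply B].
Qed.

Lemma picard_iter_continuous (G : R -> R) (L a0 a1 : R) (n : nat) :
  0 < L -> lipschitz L G -> forall t, continuous (picard_iter G a0 a1 n) t.
Proof.
  intros L0 HL. induction n as [|n IH]; intros t; simpl.
  - apply is_derive_continuous with a1. auto_derive; auto. ring.
  - eapply is_derive_continuous. exact (proj1 (picard_map_derive G L a0 a1 _ L0 HL IH) t).
Qed.

Lemma picard_iter_step (G : R -> R) (L k a0 a1 : R) :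
  0 < L -> 0 < k -> k * k = 2 * L -> lipschitz L G ->
  exists D, 0 <= D /\ forall n t,
    Rabs (picard_iter G a0 a1 (S n) t - picard_iter G a0 a1 n t)
      <= D / 2 ^ S n * weight k t.
Proof.
  (* [D] is sized for the first step: |G(a0 + a1 s)| <= |G a0| + L |a1| |s|, and both 1 and k |s|
     are at most the weight, so the bound is L D times the weight. *)
  intros L0 k0 kL HL. set (D := Rabs (G a0) / L + Rabs a1 / k).
  assert (D0 : 0 <= D).
  { apply Rplus_le_le_0_compat; apply Rdiv_le_0_compat; auto using Rabs_pos. }
  exists D. split; auto. induction n as [|n IH]; intros t.
  - rewrite pow_1. simpl picard_iter.
    assert (c0 := picard_iter_continuous G L a0 a1 0 L0 HL). simpl in c0.
    destruct (picard_map_derive G L a0 a1 _ L0 HL c0) as [y1 y2].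
    apply (weight_comparison L k D
      (fun t => picard_map G a0 a1 (fun t => a0 + a1 * t) t - (a0 + a1 * t))
      (fun t => a1 + RInt (fun s => G (a0 + a1 * s)) 0 t - a1)
      (fun t => G (a0 + a1 * t) - 0) kL D0).
    + intros s. apply (is_derive_minus (V := R_NormedModule)); auto.
      auto_derive; auto. ring.
    + intros s. apply (is_derive_minus (V := R_NormedModule)); auto.
      apply (is_derive_const (V := R_NormedModule)).
    + unfold picard_map. rewrite RInt_point_0. ring.
    + rewrite RInt_point_0. ring.
    + intros s. rewrite Rminus_0_r.
      replace (G (a0 + a1 * s)) with (G a0 + (G (a0 + a1 * s) - G a0)) by ring.
      apply Rle_trans with (1 := Rabs_triang _ _).
      generalize (HL (a0 + a1 * s) a0).
      replace (a0 + a1 * s - a0) with (a1 * s) by ring. intros Hl.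
      assert (E : L * (D * weight k s)
        = Rabs (G a0) * weight k s + L * (Rabs a1 * (/ k * weight k s))).
      { unfold D. field. lra. }
      rewrite E. apply Rplus_le_compat.
      * generalize (weight_ge_1 k s) (Rabs_pos (G a0)). nra.
      * apply Rle_trans with (1 := Hl). apply Rmult_le_compat_l; [lra|].
        rewrite Rabs_mult. apply Rmult_le_compat_l; [apply Rabs_pos|].
        generalize (weight_ge_abs k s). rewrite Rabs_mult, (Rabs_pos_eq k) by lra.
        intros Hw. apply Rmult_le_reg_l with k; auto.
        replace (k * (/ k * weight k s)) with (weight k s) by (field; lra). auto.
  - replace (D / 2 ^ S (S n)) with (D / 2 ^ S n / 2).
    2:{ simpl. field. apply pow_nonzero. lra. }
    apply (picard_map_contract G L k (D / 2 ^ S n) a0 a1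
      (picard_iter G a0 a1 (S n)) (picard_iter G a0 a1 n)); auto.
    + apply Rdiv_le_0_compat; auto. apply pow_lt. lra.
    + now apply picard_iter_continuous with L.
    + now apply picard_iter_continuous with L.
Qed.

(** Subtracting the tail C/2^(n+p) makes the induction on [p] close exactly, because each step bound
    C/2^(m+1) is the difference of consecutive tails. *)
Lemma geometric_steps_bound (u : nat -> R) (C : R) :
  (forall n, Rabs (u (S n) - u n) <= C / 2 ^ S n) ->
  forall n p, Rabs (u (n + p)%nat - u n) <= C / 2 ^ n - C / 2 ^ (n + p).
Proof.
  intros H n p. induction p as [|p IH].
  - rewrite Nat.add_0_r, !Rminus_diag, Rabs_R0. lra.
  - rewrite Nat.add_succ_r.
    replace (u (S (n + p)) - u n) with (u (S (n + p)) - u (n + p)%nat + (u (n + p)%nat - u n))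
      by ring.
    apply Rle_trans with (1 := Rabs_triang _ _). specialize (H (n + p)%nat).
    assert (C / 2 ^ (n + p) = 2 * (C / 2 ^ S (n + p))).
    { simpl. field. apply pow_nonzero. lra. }
    lra.
Qed.

Lemma div_pow2_small (C e : R) : 0 < e -> exists n, C / 2 ^ n < e.
Proof.
  intros He. destruct (Rle_dec C 0) as [p | p].
  - exists O. simpl. lra.
  - assert (P : 0 < e / C) by (apply Rdiv_lt_0_compat; lra).
    destruct (pow_lt_1_zero (/ 2)) with (y := e / C) as [N HN]; auto.
    { rewrite Rabs_pos_eq; lra. }
    exists N. specialize (HN N (le_n N)).
    rewrite Rabs_pos_eq in HN by (apply pow_le; lra).
    rewrite pow_inv in HN. unfold Rdiv in *.
    apply Rmult_lt_compat_l with (r := C) in HN; [|lra].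
    replace (C * (e * / C)) with e in HN by (field; lra). auto.
Qed.

Lemma geometric_steps_limit (u : nat -> R) (C : R) :
  0 <= C -> (forall n, Rabs (u (S n) - u n) <= C / 2 ^ S n) ->
  forall n, Rabs (real (Lim_seq u) - u n) <= C / 2 ^ n.
Proof.
  intros C0 H n.
  assert (B : forall n p, Rabs (u (n + p)%nat - u n) <= C / 2 ^ n).
  { intros m p. apply Rle_trans with (1 := geometric_steps_bound u C H m p).
    assert (0 <= C / 2 ^ (m + p)) by (apply Rdiv_le_0_compat; auto; apply pow_lt; lra).
    lra. }
  assert (L : ex_finite_lim_seq u).
  { apply ex_lim_seq_cauchy_corr. intros [e He].
    destruct (div_pow2_small C (e / 2)) as [N HN]; [lra|].
    exists N. intros i j Hi Hj. simpl.
    generalize (B N (i - N)%nat) (B N (j - N)%nat).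
    replace (N + (i - N))%nat with i by lia. replace (N + (j - N))%nat with j by lia.
    intros Bi Bj.
    apply Rabs_le_between in Bi. apply Rabs_le_between in Bj.
    apply Rabs_def1; lra. }
  apply Lim_seq_correct' in L.
  assert (L' : is_lim_seq (fun p => Rabs (u (n + p)%nat - u n))
                 (Rabs (real (Lim_seq u) - u n))).
  { apply (is_lim_seq_abs _ (Finite (real (Lim_seq u) - u n))).
    apply is_lim_seq_minus'; [|apply is_lim_seq_const].
    apply is_lim_seq_ext with (fun p => u (p + n)%nat).
    - intros p. now rewrite Nat.add_comm.
    - now apply is_lim_seq_incr_n. }
  exact (is_lim_seq_le _ _ _ _ (B n) L' (is_lim_seq_const _)).
Qed.

(** The iterates converge pointwise with an error proportional to the weight, which is locally
    bounded; so the limit is continuous and is a fixed point of the Picard map. *)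
Lemma lipschitz_second_order_exists (G : R -> R) (L a0 a1 : R) :
  0 < L -> lipschitz L G ->
  exists a da : R -> R, (forall t, is_derive a t (da t)) /\
    (forall t, is_derive da t (G (a t))) /\ a 0 = a0 /\ da 0 = a1.
Proof.
  intros L0 HL. set (k := sqrt (2 * L)).
  assert (k0 : 0 < k) by (apply sqrt_lt_R0; lra).
  assert (kL : k * k = 2 * L) by (apply sqrt_sqrt; lra).
  destruct (picard_iter_step G L k a0 a1 L0 k0 kL HL) as [D [D0 HD]].
  set (Y := picard_iter G a0 a1) in *.
  set (y := fun t => real (Lim_seq (fun n => Y n t))).
  assert (B : forall n t, Rabs (y t - Y n t) <= D / 2 ^ n * weight k t).
  { intros n t. replace (D / 2 ^ n * weight k t) with (D * weight k t / 2 ^ n)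
      by (field; apply pow_nonzero; lra).
    apply (geometric_steps_limit (fun n => Y n t)).
    - apply Rmult_le_pos; auto. left. apply weight_pos.
    - intros m. replace (D * weight k t / 2 ^ S m) with (D / 2 ^ S m * weight k t)
        by (field; apply pow_nonzero; lra).
      apply HD. }
  assert (cY : forall n t, continuous (Y n) t).
  { intros n. now apply picard_iter_continuous with L. }
  (* Three-epsilon argument: near [t] the weight is at most weight k t + 1, so one index n serves a
     whole neighbourhood. *)
  assert (cy : forall t, continuous y t).
  { intros t. apply continuous_eps. intros e He.
    destruct (div_pow2_small (D * (weight k t + 1)) (e / 3)) as [n Hn]; [lra|].
    assert (cw : continuous (weight k) t).
    { eapply is_derive_continuous. apply is_derive_weight. }
    destruct (proj1 (continuous_eps _ _) cw 1 Rlt_0_1) as [d2 [Hd2 H2]].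
    destruct (proj1 (continuous_eps _ _) (cY n t) (e / 3) ltac:(lra)) as [d1 [Hd1 H1]].
    exists (Rmin d1 d2). split; [now apply Rmin_pos|]. intros s Hs.
    assert (Hs1 := H1 s (Rlt_le_trans _ _ _ Hs (Rmin_l d1 d2))).
    assert (Hs2 := H2 s (Rlt_le_trans _ _ _ Hs (Rmin_r d1 d2))).
    assert (W : forall r, weight k r <= weight k t + 1 -> Rabs (y r - Y n r) < e / 3).
    { intros r Hr. apply Rle_lt_trans with (1 := B n r). apply Rle_lt_trans with (2 := Hn).
      unfold Rdiv. rewrite (Rmult_assoc D (_ + 1)), (Rmult_comm (_ + 1)), <- Rmult_assoc.
      apply Rmult_le_compat_l; auto. apply Rdiv_le_0_compat; auto. apply pow_lt. lra. }
    apply Rabs_def2 in Hs2. apply Rabs_def2 in Hs1.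
    assert (Ws := W s ltac:(lra)). assert (Wt := W t ltac:(lra)).
    apply Rabs_def2 in Ws. apply Rabs_def2 in Wt. apply Rabs_def1; lra. }
  assert (Fix : forall t, picard_map G a0 a1 y t = y t).
  { intros t. apply cond_eq. intros e He.
    destruct (div_pow2_small (D * weight k t) e He) as [n Hn].
    assert (p2 : 0 < 2 ^ n) by (apply pow_lt; lra).
    assert (Bn : Rabs (picard_map G a0 a1 y t - Y (S n) t) <= D / 2 ^ n / 2 * weight k t).
    { apply (picard_map_contract G L k (D / 2 ^ n) a0 a1 y (Y n)); auto.
      now apply Rdiv_le_0_compat. }
    assert (Bs := B (S n) t).
    assert (E1 : D / 2 ^ S n * weight k t = D * weight k t / 2 ^ n / 2)
      by (simpl; field; lra).
    assert (E2 : D / 2 ^ n / 2 * weight k t = D * weight k t / 2 ^ n / 2) by (field; lra).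
    rewrite E1 in Bs. rewrite E2 in Bn.
    apply Rabs_le_between in Bs. apply Rabs_le_between in Bn. apply Rabs_def1; lra. }
  destruct (picard_map_derive G L a0 a1 y L0 HL cy) as [H1 H2].
  (* The solution is given as the image of the fixed point, whose derivatives are explicit; the
     fixed-point equation serves to identify the argument of [G]. *)
  exists (picard_map G a0 a1 y), (fun t => a1 + RInt (fun s => G (y s)) 0 t).
  split; [|split; [|split]].
  - exact H1.
  - intros t. rewrite Fix. apply H2.
  - unfold picard_map. rewrite RInt_point_0. ring.
  - rewrite RInt_point_0. ring.
Qed.

Lemma is_derive_mult_exp (f : R -> R) (c x l : R) :
  is_derive f x l ->
  is_derive (fun s => f s * exp (c * s)) x ((l + c * f x) * exp (c * x)).
Proof.
  intros H. auto_derive.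
  - now exists l.
  - rewrite (is_derive_unique (fun x : R => f x) x l H). ring.
Qed.

(** Gronwall's argument for [e], the squared distance in the phase plane: |e'| <= c e makes e
    exp(-ct) nonincreasing and e exp(ct) nondecreasing, which carries e t0 = 0 to later and to
    earlier times. *)
Lemma lipschitz_second_order_unique (G : R -> R) (L t0 : R) (y dy z dz : R -> R) :
  0 < L -> lipschitz L G ->
  (forall t, is_derive y t (dy t)) -> (forall t, is_derive dy t (G (y t))) ->
  (forall t, is_derive z t (dz t)) -> (forall t, is_derive dz t (G (z t))) ->
  y t0 = z t0 -> dy t0 = dz t0 -> forall t, y t = z t /\ dy t = dz t.
Proof.
  intros L0 HL y1 y2 z1 z2 E0 E1 t.
  set (e := fun t => (y t - z t) ^ 2 + (dy t - dz t) ^ 2).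
  set (de := fun t => 2 * (y t - z t) * (dy t - dz t)
                      + 2 * (dy t - dz t) * (G (y t) - G (z t))).
  (* With v, w the differences in position and velocity, |e'| <= 2 |v| |w| + 2 L |v| |w| <= (1 + L)
     (v^2 + w^2). *)
  set (c := 1 + L).
  assert (He : forall t, is_derive e t (de t)).
  { intros s. unfold e, de. auto_derive.
    - repeat split; eexists; [apply y1 | apply z1 | apply y2 | apply z2].
    - rewrite (is_derive_unique (fun x : R => y x) _ _ (y1 s)),
        (is_derive_unique (fun x : R => z x) _ _ (z1 s)),
        (is_derive_unique (fun x : R => dy x) _ _ (y2 s)),
        (is_derive_unique (fun x : R => dz x) _ _ (z2 s)). ring. }
  assert (B : forall t, Rabs (de t) <= c * e t).
  { intros s. unfold de, e, c. set (v := y s - z s). set (w := dy s - dz s).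
    generalize (HL (y s) (z s)). fold v. set (g := G (y s) - G (z s)). intros Hg.
    replace (2 * v * w + 2 * w * g) with (2 * (v * w) + 2 * (w * g)) by ring.
    apply Rle_trans with (1 := Rabs_triang _ _).
    rewrite !Rabs_mult, (Rabs_pos_eq 2) by lra.
    rewrite <- (pow2_abs v), <- (pow2_abs w).
    generalize (Rabs_pos v) (Rabs_pos w) (pow2_ge_0 (Rabs v - Rabs w)). intros.
    assert (Rabs w * Rabs g <= Rabs w * (L * Rabs v)) by (apply Rmult_le_compat_l; auto).
    nra. }
  assert (e0 : e t0 = 0) by (unfold e; rewrite E0, E1; ring).
  assert (Hz : e t <= 0).
  { destruct (Rle_dec t0 t) as [p | p].
    - assert (M : e t0 * - exp (- c * t0) <= e t * - exp (- c * t)).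
      { apply (derive_nonneg_le (fun s => e s * - exp (- c * s))
          (fun s => (c * e s - de s) * exp (- c * s))); auto.
        - intros s _. apply (is_derive_ext (fun s => - (e s * exp (- c * s)))).
          { intros r. apply Ropp_mult_distr_r. }
          replace ((c * e s - de s) * exp (- c * s))
            with (- ((de s + - c * e s) * exp (- c * s))) by ring.
          apply (is_derive_opp (V := R_NormedModule) (fun s => e s * exp (- c * s))).
          now apply is_derive_mult_exp.
        - intros s _. apply Rmult_le_pos; [|left; apply exp_pos].
          generalize (B s). intros Bs. apply Rabs_le_between in Bs. lra. }
      rewrite e0 in M. generalize (exp_pos (- c * t)). nra.
    - assert (M : e t * exp (c * t) <= e t0 * exp (c * t0)).
      { apply (derive_nonneg_le (fun s => e s * exp (c * s))
          (fun s => (c * e s + de s) * exp (c * s))); [lra | |].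
        - intros s _. rewrite (Rplus_comm (c * e s)). now apply is_derive_mult_exp.
        - intros s _. apply Rmult_le_pos; [|left; apply exp_pos].
          generalize (B s). intros Bs. apply Rabs_le_between in Bs. lra. }
      rewrite e0 in M. generalize (exp_pos (c * t)). nra. }
  unfold e in Hz. generalize (pow2_ge_0 (y t - z t)) (pow2_ge_0 (dy t - dz t)). intros P Q.
  split; apply Rminus_diag_uniq, Rsqr_0_uniq; rewrite Rsqr_pow2; lra.
Qed.

(** * The scale factor *)

Definition force (lambda xi a : R) : R := - lambda / a + xi ^ 2 / a ^ 3.
(** An antiderivative of minus the force, so da^2/2 + potential is the energy; the term in xi^2 is
    the centrifugal barrier. *)
Definition potential (lambda xi a : R) : R := lambda * ln a + xi ^ 2 / (2 * a ^ 2).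

Lemma is_derive_potential (lambda xi a : R) :
  0 < a -> is_derive (potential lambda xi) a (- force lambda xi a).
Proof.
  intros a_pos. unfold potential, force. auto_derive.
  - repeat split; auto. apply Rgt_not_eq. nra.
  - field. lra.
Qed.

(** With p = 1/m the potential is - lambda ln p + xi^2 p^2 / 2, and ln p <= p, so the quadratic
    barrier wins for either sign of lambda. *)
Lemma potential_unbounded_at_0 (lambda xi C delta : R) :
  xi <> 0 -> 0 < delta -> exists m, 0 < m < delta /\ C < potential lambda xi m.
Proof.
  intros xi0 d0. assert (x2 : 0 < xi ^ 2) by (apply pow2_gt_0; auto).
  (* The three summands give p > 1 (so ln p > 0), 1/p < delta, and xi^2 p >= 2 (|lambda| + |C| +
     1). *)
  set (p := 1 + / delta + 2 * (Rabs lambda + Rabs C + 1) / xi ^ 2).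
  assert (id0 : 0 < / delta) by now apply Rinv_0_lt_compat.
  generalize (Rabs_pos lambda) (Rabs_pos C). intros l0 C0.
  assert (q0 : 0 < 2 * (Rabs lambda + Rabs C + 1) / xi ^ 2)
    by (apply Rdiv_lt_0_compat; lra).
  assert (p1 : 1 < p) by (unfold p; lra).
  exists (/ p). split; [split|].
  - apply Rinv_0_lt_compat. lra.
  - rewrite <- (Rinv_inv delta). apply Rinv_0_lt_contravar; auto. unfold p. lra.
  - unfold potential. rewrite ln_Rinv by lra.
    rewrite pow_inv. replace (xi ^ 2 / (2 * / p ^ 2)) with (xi ^ 2 * p ^ 2 / 2).
    2:{ field. lra. }
    assert (lp0 : 0 < ln p) by (rewrite <- ln_1; apply ln_increasing; lra).
    assert (lp1 : ln p <= p).
    { rewrite <- (ln_exp p) at 2. apply ln_le; [lra|].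
      generalize (exp_ineq1_le p). lra. }
    assert (A : - (Rabs lambda * p) <= lambda * - ln p).
    { generalize (Rle_abs lambda). intros. nra. }
    assert (B : 2 * (Rabs lambda + Rabs C + 1) <= xi ^ 2 * p).
    { replace (xi ^ 2 * p)
        with (2 * (Rabs lambda + Rabs C + 1) + (xi ^ 2 + xi ^ 2 * / delta))
        by (unfold p; field; lra).
      generalize (Rmult_lt_0_compat _ _ x2 id0). lra. }
    assert (B' : 2 * (Rabs lambda + Rabs C + 1) * p <= xi ^ 2 * p * p)
      by (apply Rmult_le_compat_r; lra).
    generalize (Rle_abs C). intros. nra.
Qed.

Lemma is_derive_force (lambda xi a : R) :
  0 < a -> is_derive (force lambda xi) a (lambda / a ^ 2 - 3 * xi ^ 2 / a ^ 4).
Proof.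
  intros a_pos. assert (a3 := pow_lt a 3 a_pos). unfold force. auto_derive.
  - simpl in a3. repeat split; lra.
  - field. lra.
Qed.

Definition truncated_force (lambda xi m a : R) : R := force lambda xi (Rmax a m).

(** On [m, infinity) both terms of the derivative of the force are largest in size at [m], and
    clamping by [Rmax] does not increase distances. The summand 1 in [L] ensures L > 0. *)
Lemma truncated_force_lipschitz (lambda xi m : R) :
  0 < m -> exists L, 0 < L /\ lipschitz L (truncated_force lambda xi m).
Proof.
  intros m0. set (L := Rabs lambda / m ^ 2 + 3 * xi ^ 2 / m ^ 4 + 1).
  assert (m2 : 0 < m ^ 2) by (apply pow_lt; auto).
  assert (m4 : 0 < m ^ 4) by (apply pow_lt; auto).
  assert (L0 : 0 < L).
  { assert (0 <= Rabs lambda / m ^ 2) by (apply Rdiv_le_0_compat; auto using Rabs_pos).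
    assert (0 <= 3 * xi ^ 2 / m ^ 4)
      by (apply Rdiv_le_0_compat; auto; generalize (pow2_ge_0 xi); lra).
    unfold L. lra. }
  exists L. split; auto. intros u v. unfold truncated_force.
  set (u' := Rmax u m). set (v' := Rmax v m).
  assert (Hu : m <= u') by apply Rmax_r. assert (Hv : m <= v') by apply Rmax_r.
  assert (Huv : Rabs (u' - v') <= Rabs (u - v)).
  { unfold u', v', Rmax, Rabs.
    destruct (Rle_dec u m), (Rle_dec v m); repeat destruct Rcase_abs; lra. }
  apply Rle_trans with (L * Rabs (u' - v')); [|apply Rmult_le_compat_l; lra].
  destruct (MVT_gen (force lambda xi) v' u' (fun a => lambda / a ^ 2 - 3 * xi ^ 2 / a ^ 4))
    as [c [Hc E]].
  - intros x Hx. assert (0 < x).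
    { generalize (Rmin_glb _ _ _ Hv Hu). lra. }
    now apply is_derive_force.
  - intros x Hx. assert (0 < x).
    { generalize (Rmin_glb _ _ _ Hv Hu). lra. }
    apply is_derive_continuity_pt with (lambda / x ^ 2 - 3 * xi ^ 2 / x ^ 4).
    now apply is_derive_force.
  - rewrite E, Rabs_mult. apply Rmult_le_compat_r; [apply Rabs_pos|].
    assert (mc : m <= c) by (generalize (Rmin_glb _ _ _ Hv Hu); lra).
    assert (c2 : / c ^ 2 <= / m ^ 2).
    { apply Rinv_le_contravar; auto. apply pow_incr. lra. }
    assert (c4 : / c ^ 4 <= / m ^ 4).
    { apply Rinv_le_contravar; auto. apply pow_incr. lra. }
    assert (p2 : 0 < / c ^ 2) by (apply Rinv_0_lt_compat, pow_lt; lra).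
    assert (p4 : 0 < / c ^ 4) by (apply Rinv_0_lt_compat, pow_lt; lra).
    unfold L, Rdiv.
    apply Rle_trans with (1 := Rabs_triang _ _). rewrite Rabs_Ropp, Rabs_mult.
    rewrite (Rabs_pos_eq (/ c ^ 2)) by lra.
    rewrite (Rabs_pos_eq (3 * xi ^ 2 * / c ^ 4))
      by (generalize (pow2_ge_0 xi); intros; apply Rmult_le_pos; lra).
    assert (Rabs lambda * / c ^ 2 <= Rabs lambda * / m ^ 2)
      by (apply Rmult_le_compat_l; auto using Rabs_pos).
    assert (3 * xi ^ 2 * / c ^ 4 <= 3 * xi ^ 2 * / m ^ 4)
      by (apply Rmult_le_compat_l; auto; generalize (pow2_ge_0 xi); lra).
    lra.
Qed.

(** The bound [m] is carried along because two solutions above the same [m] solve the same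
    truncated, Lipschitz equation; all of R is covered so that time can be reflected. *)
Definition scale_solution (lambda xi m : R) (a da : R -> R) : Prop :=
  0 < m /\ (forall t, m < a t) /\ (forall t, is_derive a t (da t)) /\
  (forall t, is_derive da t (force lambda xi (a t))).

(** The antiderivative [W] of the truncated force is defined for every real argument, so da^2/2 -
    W(a) is constant even if [a] dips below [m] or 0 in between; on [m, infinity) the sum W +
    potential is constant. *)
Lemma truncated_energy (lambda xi m a0 : R) (a da : R -> R) :
  0 < m -> m <= a0 -> (forall t, is_derive a t (da t)) ->
  (forall t, is_derive da t (truncated_force lambda xi m (a t))) -> a 0 = a0 ->
  forall t, m <= a t ->
  da t ^ 2 / 2 + potential lambda xi (a t) = da 0 ^ 2 / 2 + potential lambda xi a0.
Proof.
  intros m0 ma H1 H2 E0 t Ht.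
  destruct (truncated_force_lipschitz lambda xi m m0) as [L [L0 HL]].
  set (g := truncated_force lambda xi m) in *. set (W := RInt g a0).
  assert (HW : forall u, is_derive W u (g u)).
  { intros u. apply is_derive_RInt_continuous. intros x. now apply lipschitz_continuous with L. }
  assert (W0 : W a0 = 0) by (unfold W; rewrite RInt_point_0; reflexivity).
  assert (EW : W (a t) + potential lambda xi (a t) = potential lambda xi a0).
  { rewrite <- (Rplus_0_l (potential lambda xi a0)), <- W0.
    apply (derive_zero_const (fun u => W u + potential lambda xi u)).
    intros x Hx. assert (mx : m <= x) by (generalize (Rmin_glb _ _ _ Ht ma); lra).
    replace 0 with (g x + - force lambda xi x).
    - apply (is_derive_plus (V := R_NormedModule)); auto. apply is_derive_potential. lra.
    - unfold g, truncated_force. rewrite Rmax_left by lra. ring. }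
  assert (EE : da t ^ 2 / 2 - W (a t) = da 0 ^ 2 / 2 - W (a 0)).
  { apply (derive_zero_const (fun s => da s ^ 2 / 2 - W (a s))). intros s _.
    auto_derive.
    - repeat split; eexists; [apply H2 | apply HW | apply H1].
    - rewrite (is_derive_unique (fun x : R => da x) _ _ (H2 s)),
        (is_derive_unique (fun x : R => a x) _ _ (H1 s)),
        (is_derive_unique (fun x : R => W x) _ _ (HW (a s))). field. }
  rewrite E0, W0 in EE. lra.
Qed.

Lemma is_derive_continuity (f df : R -> R) :
  (forall t, is_derive f t (df t)) -> continuity f.
Proof. intros H t. exact (is_derive_continuity_pt _ _ _ (H t)). Qed.

Lemma scale_solution_exists (lambda xi a0 a1 : R) :
  xi <> 0 -> 0 < a0 -> exists m a da, scale_solution lambda xi m a da /\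
    a 0 = a0 /\ da 0 = a1 /\ forall t,
    da t ^ 2 / 2 + potential lambda xi (a t) = a1 ^ 2 / 2 + potential lambda xi a0.
Proof.
  intros xi0 a0_pos.
  destruct (potential_unbounded_at_0 lambda xi (a1 ^ 2 / 2 + potential lambda xi a0) a0 xi0 a0_pos)
    as [m [[m0 ma] Hm]].
  destruct (truncated_force_lipschitz lambda xi m m0) as [L [L0 HL]].
  destruct (lipschitz_second_order_exists _ L a0 a1 L0 HL) as [a [da [H1 [H2 [E0 E1]]]]].
  assert (En := truncated_energy lambda xi m a0 a da m0 ltac:(lra) H1 H2 E0).
  rewrite E1 in En.
  assert (ne : forall t, a t <> m).
  { intros t Et. generalize (En t ltac:(lra)) (pow2_ge_0 (da t)). rewrite Et. lra. }
  assert (cam : continuity (fun t => a t - m)).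
  { apply (is_derive_continuity _ da). intros t.
    replace (da t) with (da t - 0) by ring.
    apply (is_derive_minus (V := R_NormedModule)); auto.
    apply (is_derive_const (V := R_NormedModule)). }
  assert (Ha : forall t, m < a t).
  { intros t. destruct (Rlt_dec m (a t)) as [p | p]; auto. exfalso.
    destruct (Rle_dec 0 t) as [q | q].
    - destruct (IVT_cor _ 0 t cam q) as [z [_ Hz]]; [rewrite E0; nra|].
      apply (ne z). lra.
    - destruct (IVT_cor _ t 0 cam) as [z [_ Hz]]; [lra | rewrite E0; nra|].
      apply (ne z). lra. }
  exists m, a, da. split; [split; [|split; [|split]]|split; [|split]]; auto.
  - intros t. generalize (H2 t). unfold truncated_force.
    rewrite Rmax_left; auto. left. apply Ha.
  - intros t. apply En. left. apply Ha.
Qed.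

Lemma scale_solution_unique (lambda xi m t0 : R) (a da b db : R -> R) :
  scale_solution lambda xi m a da -> scale_solution lambda xi m b db ->
  a t0 = b t0 -> da t0 = db t0 -> forall t, a t = b t /\ da t = db t.
Proof.
  intros [m0 [am [a1 a2]]] [_ [bm [b1 b2]]] E0 E1.
  destruct (truncated_force_lipschitz lambda xi m m0) as [L [L0 HL]].
  apply (lipschitz_second_order_unique _ L t0 a da b db L0 HL); auto; intros t;
    unfold truncated_force; rewrite Rmax_left; auto; left; auto.
Qed.

(** The force depends on the position alone, so the equation survives time reversal; only the
    velocity changes sign. *)
Lemma scale_solution_reflect (lambda xi m t1 : R) (a da : R -> R) :
  scale_solution lambda xi m a da ->
  scale_solution lambda xi m (fun t => a (2 * t1 - t)) (fun t => - da (2 * t1 - t)).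
Proof.
  intros [m0 [am [H1 H2]]]. split; [|split; [|split]]; auto; intros t.
  - auto_derive.
    + eexists. apply H1.
    + rewrite (is_derive_unique (fun x : R => a x) _ _ (H1 _)).
      rewrite <- ?Rminus_def. ring.
  - auto_derive.
    + eexists. apply H2.
    + rewrite (is_derive_unique (fun x : R => da x) _ _ (H2 _)).
      rewrite <- ?Rminus_def. ring.
Qed.

(** At a turning point the reflected solution has the same position and the same zero velocity, so
    uniqueness identifies the two. *)
Lemma scale_turning_point_symmetry (lambda xi m t1 : R) (a da : R -> R) :
  scale_solution lambda xi m a da -> da t1 = 0 ->
  forall t, a t = a (2 * t1 - t) /\ da t = - da (2 * t1 - t).
Proof.
  intros H Z.
  apply (scale_solution_unique lambda xi m t1 _ _ _ _ H (scale_solution_reflect _ _ _ t1 _ _ H));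
    replace (2 * t1 - t1) with t1 by ring; auto.
  rewrite Z. ring.
Qed.

(* A velocity of constant sign would push a past the equilibrium, after which the
   force has the opposite sign and stays bounded away from 0. *)
Lemma scale_turning_point (lambda xi m M t0 : R) (a da : R -> R) :
  0 < lambda -> scale_solution lambda xi m a da -> (forall t, a t <= M) ->
  exists t, t0 <= t /\ da t = 0.
Proof.
  intros l0 [m0 [am [H1 H2]]] aM.
  apply NNPP. intros N.
  assert (nz : forall t, t0 <= t -> da t <> 0) by (intros t p q; apply N; now exists t).
  assert (cda := is_derive_continuity _ _ H2).
  assert (F : forall t, force lambda xi (a t) = (xi ^ 2 - lambda * a t ^ 2) / a t ^ 3).
  { intros t. unfold force. specialize (am t). field. lra. }
  assert (p3 : forall t, 0 < a t ^ 3) by (intros t; apply pow_lt; specialize (am t); lra).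
  assert (M0 : m < M) by (specialize (am 0); specialize (aM 0); lra).
  assert (M3 : 0 < M ^ 3) by (apply pow_lt; lra).
  assert (inv : forall t, / M ^ 3 <= / a t ^ 3).
  { intros t. apply Rinv_le_contravar; auto. apply pow_incr.
    specialize (am t); specialize (aM t); lra. }
  (* Each of the four cases below ends in this contradiction: a slope of at least c > 0 from [s] on
     exceeds any bound [B]. *)
  assert (grow : forall (h dh : R -> R) (s c B : R), 0 < c -> (forall t, is_derive h t (dh t)) ->
            (forall t, s <= t -> c <= dh t) -> (forall t, s <= t -> h t <= B) -> False).
  { intros h dh s c B c0 Hh Hc HB.
    set (T := s + (Rabs (B - h s) + 1) / c).
    assert (sT : s <= T).
    { unfold T. assert (0 <= (Rabs (B - h s) + 1) / c); [|lra].
      apply Rdiv_le_0_compat; auto. generalize (Rabs_pos (B - h s)). lra. }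
    destruct (MVT_le h dh s T sT) as [z [Hz E]]; auto.
    specialize (Hc z ltac:(lra)). specialize (HB T sT).
    assert (c * (T - s) = Rabs (B - h s) + 1) by (unfold T; field; lra).
    generalize (Rle_abs (B - h s)). nra. }
  assert (sign : (forall t, t0 <= t -> 0 < da t) \/ (forall t, t0 <= t -> da t < 0)).
  { assert (IV : forall t, t0 <= t -> 0 < da t0 * da t).
    { intros t Ht. destruct (Rle_dec (da t0 * da t) 0) as [p | p]; [|lra]. exfalso.
      destruct (IVT_cor da t0 t cda Ht p) as [z [Hz Ez]]. apply (nz z); auto. lra. }
    destruct (Rlt_dec 0 (da t0)) as [p | p]; [left | right]; intros t Ht;
      specialize (IV t Ht); nra. }
  destruct sign as [S | S].
  (* Expanding: once [a] is past the equilibrium, the velocity falls at a rate bounded away from 0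
     (as a^3 <= M^3) and cannot stay positive; if [a] never passes it, the force is nonnegative, the
     velocity stays at least da t0, and [a] exceeds [M]. *)
  - destruct (classic (exists t1, t0 <= t1 /\ xi ^ 2 < lambda * a t1 ^ 2)) as [[t1 [Ht1 E1]] | Q].
    + apply (grow (fun t => - da t) (fun t => - force lambda xi (a t)) t1
        ((lambda * a t1 ^ 2 - xi ^ 2) / M ^ 3) 0).
      * apply Rdiv_lt_0_compat; lra.
      * intros t. now apply (is_derive_opp (V := R_NormedModule) da).
      * intros t Ht. rewrite F.
        assert (mono : a t1 <= a t).
        { apply derive_nonneg_le with da; auto. intros x Hx. left. apply S. lra. }
        assert (sq : a t1 ^ 2 <= a t ^ 2) by (apply pow_incr; specialize (am t1); lra).
        unfold Rdiv. rewrite Ropp_mult_distr_l.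
        specialize (inv t). specialize (p3 t).
        apply Rmult_le_compat; [nra | left; now apply Rinv_0_lt_compat | nra | auto].
      * intros t Ht. specialize (S t ltac:(lra)). lra.
    + apply (grow a da t0 (da t0) M); auto. { apply S; lra. }
      intros t Ht. apply derive_nonneg_le with (fun t => force lambda xi (a t)); auto.
      intros x Hx. rewrite F. apply Rdiv_le_0_compat; auto.
      destruct (Rle_dec (lambda * a x ^ 2) (xi ^ 2)); [lra|]. exfalso. apply Q.
      exists x. lra.
  (* Contracting: the mirror image, except that an [a] which never drops below the equilibrium would
     be driven below 0 instead of above [M]. *)
  - destruct (classic (exists t1, t0 <= t1 /\ lambda * a t1 ^ 2 < xi ^ 2)) as [[t1 [Ht1 E1]] | Q].
    + apply (grow da (fun t => force lambda xi (a t)) t1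
        ((xi ^ 2 - lambda * a t1 ^ 2) / M ^ 3) 0).
      * apply Rdiv_lt_0_compat; lra.
      * auto.
      * intros t Ht. rewrite F.
        assert (mono : - a t1 <= - a t).
        { apply (derive_nonneg_le (fun t => - a t) (fun t => - da t)); auto.
          - intros x _. now apply (is_derive_opp (V := R_NormedModule) a).
          - intros x Hx. specialize (S x ltac:(lra)). lra. }
        assert (sq : a t ^ 2 <= a t1 ^ 2) by (apply pow_incr; specialize (am t); lra).
        unfold Rdiv. specialize (inv t).
        apply Rmult_le_compat; [nra | left; now apply Rinv_0_lt_compat | nra | auto].
      * intros t Ht. specialize (S t ltac:(lra)). lra.
    + apply (grow (fun t => - a t) (fun t => - da t) t0 (- da t0) 0); auto.
      * specialize (S t0 ltac:(lra)). lra.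
      * intros t. now apply (is_derive_opp (V := R_NormedModule) a).
      * intros t Ht.
        apply (derive_nonneg_le (fun t => - da t) (fun t => - force lambda xi (a t))); auto.
        -- intros x _. now apply (is_derive_opp (V := R_NormedModule) da).
        -- intros x Hx. rewrite F. unfold Rdiv. rewrite Ropp_mult_distr_l.
           apply Rdiv_le_0_compat; auto.
           destruct (Rle_dec (xi ^ 2) (lambda * a x ^ 2)); [lra|]. exfalso. apply Q.
           exists x. lra.
      * intros t _. specialize (am t). lra.
Qed.

Lemma scale_periodic (lambda xi m M : R) (a da : R -> R) :
  0 < lambda -> scale_solution lambda xi m a da -> (forall t, a t <= M) ->
  exists T, 0 < T /\ forall t, a (t + T) = a t /\ da (t + T) = da t.
Proof.
  intros l0 H aM.
  destruct (scale_turning_point lambda xi m M 0 a da l0 H aM) as [t1 [_ E1]].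
  (* Starting the search at t1 + 1 makes the two turning points distinct, so that T > 0. *)
  destruct (scale_turning_point lambda xi m M (t1 + 1) a da l0 H aM) as [t2 [Ht2 E2]].
  exists (2 * (t2 - t1)). split; [lra|]. intros t.
  destruct (scale_turning_point_symmetry _ _ _ t1 a da H E1 t) as [A1 B1].
  destruct (scale_turning_point_symmetry _ _ _ t2 a da H E2 (t + 2 * (t2 - t1))) as [A2 B2].
  replace (2 * t2 - (t + 2 * (t2 - t1))) with (2 * t1 - t) in A2, B2 by ring.
  split; congruence.
Qed.

(** Kinetic energy and barrier are nonnegative, so lambda ln a <= E. *)
Lemma scale_bounded_above (lambda xi E : R) (a da : R -> R) :
  0 < lambda -> (forall t, 0 < a t) ->
  (forall t, da t ^ 2 / 2 + potential lambda xi (a t) = E) ->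
  forall t, a t <= exp (E / lambda).
Proof.
  intros l0 Ha En t. specialize (En t). unfold potential in En. specialize (Ha t).
  rewrite <- (exp_ln (a t)) by auto.
  assert (H : ln (a t) <= E / lambda).
  { apply Rmult_le_reg_l with lambda; auto.
    replace (lambda * (E / lambda)) with E by (field; lra).
    assert (0 <= xi ^ 2 / (2 * a t ^ 2)).
    { apply Rdiv_le_0_compat; [apply pow2_ge_0|]. generalize (pow_lt (a t) 2 Ha). lra. }
    generalize (pow2_ge_0 (da t)). lra. }
  destruct H as [H | H]; [left; now apply exp_increasing | right; now rewrite H].
Qed.

(** The force factors as (|xi| - a sqrt lambda) (|xi| + a sqrt lambda) / a^3, whose second factor is
    positive. *)
Lemma force_zero_iff (lambda xi a : R) :
  0 < lambda -> 0 < a -> force lambda xi a = 0 <-> a = Rabs xi / sqrt lambda.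
Proof.
  intros l0 a_pos. assert (s0 := sqrt_lt_R0 lambda l0).
  assert (ss : sqrt lambda * sqrt lambda = lambda) by (apply sqrt_sqrt; lra).
  assert (F : force lambda xi a
    = (Rabs xi - a * sqrt lambda) * (Rabs xi + a * sqrt lambda) / a ^ 3).
  { unfold force. rewrite <- (pow2_abs xi), <- ss at 1. field. lra. }
  assert (P : 0 < Rabs xi + a * sqrt lambda).
  { generalize (Rabs_pos xi) (Rmult_lt_0_compat _ _ a_pos s0). lra. }
  split.
  - intros Z. rewrite F in Z.
    assert (Z' : (Rabs xi - a * sqrt lambda) * (Rabs xi + a * sqrt lambda) = 0).
    { apply Rmult_eq_reg_r with (/ a ^ 3).
      - unfold Rdiv in Z. rewrite Z. ring.
      - apply Rinv_neq_0_compat, pow_nonzero. lra. }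
    apply Rmult_integral in Z'. destruct Z' as [Z' | Z']; [|lra].
    apply Rmult_eq_reg_r with (sqrt lambda); [|lra]. field_simplify; lra.
  - intros E. assert (E' : a * sqrt lambda = Rabs xi) by (rewrite E; field; lra).
    rewrite F, E'. field. lra.
Qed.

(** * The radial profile as a function of the squared radius *)

Lemma locally_neq_0 (x : R) : x <> 0 -> locally x (fun y => y <> 0).
Proof.
  intros H. exists (mkposreal _ (Rabs_pos_lt x H)). intros y Hy E.
  unfold ball in Hy; simpl in Hy. unfold AbsRing_ball, abs, minus, plus, opp in Hy; simpl in Hy.
  rewrite E, Rplus_0_l, Rabs_Ropp in Hy. lra.
Qed.

(** By the mean value theorem the difference quotient at [x0] is a value of [dg] at a point no
    farther from [x0] than the increment. This supplies the derivative of [avg] at 0, where the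
    quotient rule fails. *)
Lemma is_derive_continuous_extension (g dg : R -> R) (x0 : R) :
  (forall x, x <> x0 -> is_derive g x (dg x)) -> continuous g x0 -> continuous dg x0 ->
  is_derive g x0 (dg x0).
Proof.
  intros H cg cdg. apply is_derive_Reals. intros e He.
  destruct (proj1 (continuous_eps dg x0) cdg e He) as [d [Hd P]].
  exists (mkposreal d Hd). intros h h0 hd. simpl in hd.
  destruct (MVT_gen g x0 (x0 + h) dg) as [c [Hc E]].
  - intros x Hx. apply H. intros Ex. subst x.
    unfold Rmin, Rmax in Hx. destruct (Rle_dec x0 (x0 + h)); lra.
  - intros x Hx. destruct (Req_dec x x0) as [-> | ne].
    + now apply continuity_pt_filterlim.
    + apply is_derive_continuity_pt with (dg x). auto.
  - rewrite E. replace (dg c * (x0 + h - x0) / h) with (dg c) by (field; auto).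
    apply P. apply Rle_lt_trans with (2 := hd).
    unfold Rmin, Rmax in Hc. unfold Rabs. destruct (Rle_dec x0 (x0 + h));
      destruct (Rcase_abs (c - x0)), (Rcase_abs h); lra.
Qed.

Definition avg (E : R -> R) (z : R) : R :=
  if Req_EM_T z 0 then E 0 else RInt E 0 z / z.

(** Differentiating z avg(z) = int_0^z E gives (E - avg)/z; its limit at 0 is half of dE 0, because
    [avg] averages E(0) + s dE(0) over [0, z]. *)
Definition davg (E dE : R -> R) (z : R) : R :=
  if Req_EM_T z 0 then dE 0 / 2 else (E z - avg E z) / z.

Lemma avg_0 (E : R -> R) : avg E 0 = E 0.
Proof. unfold avg. destruct (Req_EM_T 0 0); lra. Qed.

Lemma avg_neq_0 (E : R -> R) (z : R) : z <> 0 -> avg E z = RInt E 0 z / z.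
Proof. intros H. unfold avg. destruct (Req_EM_T z 0); lra. Qed.

Lemma mult_avg (E : R -> R) (z : R) : z * avg E z = RInt E 0 z.
Proof.
  destruct (Req_dec z 0) as [-> | H].
  - rewrite RInt_point_0. ring.
  - rewrite avg_neq_0 by auto. field. auto.
Qed.

(** Yields continuity of the average at 0, since [c] tends to 0 with [z]. *)
Lemma avg_mean_value (E : R -> R) (z : R) :
  (forall x, continuous E x) -> exists c, Rabs c <= Rabs z /\ avg E z = E c.
Proof.
  intros cE. destruct (Req_dec z 0) as [-> | H].
  - exists 0. split; [lra | apply avg_0].
  - destruct (MVT_gen (RInt E 0) 0 z E) as [c [Hc Ec]].
    + intros x _. now apply is_derive_RInt_continuous.
    + intros x _. apply is_derive_continuity_pt with (E x).
      now apply is_derive_RInt_continuous.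
    + rewrite RInt_point_0 in Ec. exists c. split.
      * unfold Rmin, Rmax in Hc. unfold Rabs.
        destruct (Rle_dec 0 z), (Rcase_abs c), (Rcase_abs z); lra.
      * rewrite avg_neq_0 by auto. replace (RInt E 0 z) with (E c * z) by lra. field. auto.
Qed.

Lemma is_derive_avg_neq_0 (E dE : R -> R) (z : R) :
  (forall x, continuous E x) -> z <> 0 -> is_derive (avg E) z (davg E dE z).
Proof.
  intros cE H. apply (is_derive_ext_loc (fun z => RInt E 0 z / z)).
  - apply filter_imp with (2 := locally_neq_0 z H). intros y Hy. now rewrite avg_neq_0.
  - assert (D := is_derive_div (RInt E 0) (fun z => z) z (E z) 1
      (is_derive_RInt_continuous E 0 z cE) (is_derive_id (K := R_AbsRing) z) H).
    replace (davg E dE z) with ((E z * z - RInt E 0 z * 1) / z ^ 2); [exact D|].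
    unfold davg. destruct (Req_EM_T z 0); [lra|]. rewrite avg_neq_0 by auto. field. auto.
Qed.

Lemma avg_continuous (E : R -> R) (z : R) :
  (forall x, continuous E x) -> continuous (avg E) z.
Proof.
  intros cE. destruct (Req_dec z 0) as [-> | H].
  - apply continuous_eps. intros e He.
    destruct (proj1 (continuous_eps E 0) (cE 0) e He) as [d [Hd P]].
    exists d. split; auto. intros y Hy.
    destruct (avg_mean_value E y cE) as [c [Hc ->]]. rewrite avg_0. apply P.
    rewrite Rminus_0_r in *. lra.
  - eapply is_derive_continuous. now apply (is_derive_avg_neq_0 E (fun _ => 0)).
Qed.

(* At 0 the numerator H = z E - int_0^z E satisfies H' = z E', so H = E'(0) z^2 / 2 + o(z^2). *)
Lemma davg_continuous (E dE : R -> R) (z : R) :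
  (forall x, is_derive E x (dE x)) -> (forall x, continuous dE x) ->
  continuous (davg E dE) z.
Proof.
  intros HE cdE.
  assert (cE : forall x, continuous E x) by (intros x; eapply is_derive_continuous; apply HE).
  destruct (Req_dec z 0) as [-> | H].
  - apply continuous_eps. intros e He.
    destruct (proj1 (continuous_eps dE 0) (cdE 0) (e / 2) ltac:(lra)) as [d [Hd P]].
    exists d. split; auto. intros y Hy. rewrite Rminus_0_r in Hy.
    unfold davg at 2. destruct (Req_EM_T 0 0) as [_ | F]; [|lra].
    unfold davg. destruct (Req_EM_T y 0) as [_ | ny].
    { rewrite Rminus_diag, Rabs_R0. auto. }
    assert (HM : forall x, is_derive (fun s => s * E s - RInt E 0 s - dE 0 / 2 * s ^ 2) x
                   (x * (dE x - dE 0))).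
    { intros x. assert (HN := is_derive_RInt_continuous E 0 x cE).
      revert HN. generalize (RInt E 0). intros N HN. auto_derive.
      - repeat split; eexists; [apply HE | exact HN].
      - rewrite (is_derive_unique (fun x : R => E x) _ _ (HE x)),
          (is_derive_unique (fun x : R => N x) _ _ HN). field. }
    destruct (MVT_gen (fun s => s * E s - RInt E 0 s - dE 0 / 2 * s ^ 2) 0 y
      (fun s => s * (dE s - dE 0))) as [c [Hc Ec]].
    + intros x _. apply HM.
    + intros x _. eapply is_derive_continuity_pt. apply HM.
    + rewrite RInt_point_0 in Ec. rewrite avg_neq_0 by auto.
      assert (cy : Rabs c <= Rabs y).
      { unfold Rmin, Rmax in Hc. unfold Rabs.
        destruct (Rle_dec 0 y), (Rcase_abs c), (Rcase_abs y); lra. }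
      replace ((E y - RInt E 0 y / y) / y - dE 0 / 2)
        with (c * (dE c - dE 0) * y / (y * y)).
      2:{ replace (c * (dE c - dE 0) * y)
            with (y * E y - RInt E 0 y - dE 0 / 2 * (y * y)) by lra. field. auto. }
      replace (c * (dE c - dE 0) * y / (y * y)) with (c / y * (dE c - dE 0)) by (field; auto).
      rewrite Rabs_mult. specialize (P c). rewrite Rminus_0_r in P. specialize (P ltac:(lra)).
      assert (q : Rabs (c / y) <= 1).
      { rewrite Rabs_div by auto. apply Rabs_pos_lt in ny.
        apply Rmult_le_reg_r with (Rabs y); auto. field_simplify; lra. }
      generalize (Rabs_pos (dE c - dE 0)) (Rabs_pos (c / y)). nra.
  - apply (continuous_ext_loc _ (fun z => (E z - avg E z) / z)).
    + apply filter_imp with (2 := locally_neq_0 z H). intros y Hy. unfold davg.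
      destruct (Req_EM_T y 0); [contradiction | auto].
    + eapply is_derive_continuous.
      apply (is_derive_div (fun z => E z - avg E z) (fun z => z) z
        (dE z - davg E dE z) 1).
      * apply (is_derive_minus (V := R_NormedModule)); [apply HE|].
        now apply (is_derive_avg_neq_0 E dE).
      * apply (is_derive_id (K := R_AbsRing)).
      * auto.
Qed.

Lemma is_derive_avg (E dE : R -> R) (z : R) :
  (forall x, is_derive E x (dE x)) -> (forall x, continuous dE x) ->
  is_derive (avg E) z (davg E dE z).
Proof.
  intros HE cdE.
  assert (cE : forall x, continuous E x) by (intros x; eapply is_derive_continuous; apply HE).
  destruct (Req_dec z 0) as [-> | H].
  - apply is_derive_continuous_extension.
    + intros x Hx. now apply is_derive_avg_neq_0.
    + now apply avg_continuous.
    + now apply davg_continuous.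
  - now apply is_derive_avg_neq_0.
Qed.

(* The constant of integration vanishes because the mean value
   theorem at 0 provides points s -> 0 with df s bounded. *)
Lemma profile_first_integral (K lambda : R) (f df d2f : R -> R) :
  0 < K ->
  (forall s, 0 <= s -> is_derive f s (df s)) ->
  (forall s, 0 < s -> is_derive df s (d2f s)) ->
  (forall s, 0 < s -> d2f s + df s / s + 2 * PI / K * exp (f s) = 2 * lambda / K) ->
  df 0 = 0 -> (forall z, continuous (fun z => exp (f (sqrt z))) z) ->
  forall s, 0 < s ->
    K * s * df s = lambda * s ^ 2 - PI * RInt (fun z => exp (f (sqrt z))) 0 (s ^ 2).
Proof.
  intros K0 H1 H2 ode Z cE s s0.
  set (N := RInt (fun z => exp (f (sqrt z))) 0).
  assert (HN : forall z, is_derive N z (exp (f (sqrt z)))).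
  { intros z. now apply (is_derive_RInt_continuous (fun z => exp (f (sqrt z)))). }
  (* Multiplied by K s, the profile equation reads (K s f')' + 2 pi s e^f = 2 lambda s; the
     substitution z = s^2 makes [Q] an antiderivative of 2 pi s e^f - 2 lambda s. *)
  set (Q := fun s => PI * N (s ^ 2) - lambda * s ^ 2).
  assert (HQ : forall x, 0 <= x ->
    is_derive Q x (PI * (2 * x * exp (f x)) - 2 * lambda * x)).
  { intros x Hx. unfold Q. auto_derive.
    - eexists. apply HN.
    - rewrite (is_derive_unique (fun x : R => N x) _ _ (HN _)).
      replace (x * (x * 1)) with (x ^ 2) by ring. rewrite sqrt_pow2 by auto. ring. }
  assert (Q0 : Q 0 = 0).
  { unfold Q. replace (0 ^ 2) with 0 by ring. unfold N. rewrite RInt_point_0. ring. }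
  set (J := fun s => K * s * df s + Q s).
  assert (HJ : forall x, 0 < x -> is_derive J x 0).
  { intros x x0. unfold J. auto_derive.
    - split; [|split; auto]; eexists; [now apply H2 | apply HQ; lra].
    - rewrite (is_derive_unique (fun x : R => df x) _ _ (H2 x x0)),
        (is_derive_unique (fun x : R => Q x) _ _ (HQ x ltac:(lra))).
      replace (d2f x) with (2 * lambda / K - df x / x - 2 * PI / K * exp (f x))
        by (specialize (ode x x0); lra).
      field. lra. }
  assert (J s = 0); [|unfold J, Q in *; lra].
  apply cond_eq. intros e He. rewrite Rminus_0_r.
  assert (cQ : continuous Q 0) by (eapply is_derive_continuous; apply HQ; lra).
  destruct (proj1 (continuous_eps Q 0) cQ (e / 2) ltac:(lra)) as [d1 [Hd1 P1]].
  assert (D0 := proj1 (is_derive_Reals f 0 (df 0)) (H1 0 ltac:(lra)) 1 Rlt_0_1).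
  destruct D0 as [[d2 Hd2] P2]. simpl in P2.
  (* For the mean value point c in (0, h): h < d1 makes Q(c) small, h < d2 gives |df c| < 1 through
     the difference quotient at 0, h < s puts c before s, and h < e/(2K) bounds K c. *)
  set (h := Rmin (Rmin d1 d2) (Rmin s (e / (2 * K))) / 2).
  assert (eK : 0 < e / (2 * K)) by (apply Rdiv_lt_0_compat; lra).
  assert (hb : 0 < h /\ h < d1 /\ h < d2 /\ h < s /\ h < e / (2 * K)).
  { assert (hp : 0 < Rmin (Rmin d1 d2) (Rmin s (e / (2 * K))))
      by (repeat apply Rmin_pos; auto).
    generalize (Rmin_l (Rmin d1 d2) (Rmin s (e / (2 * K))))
      (Rmin_r (Rmin d1 d2) (Rmin s (e / (2 * K))))
      (Rmin_l d1 d2) (Rmin_r d1 d2) (Rmin_l s (e / (2 * K))) (Rmin_r s (e / (2 * K))).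
    unfold h. intros. repeat split; lra. }
  destruct hb as [h0 [hd1 [hd2 [hs hK]]]].
  destruct (MVT_cor2 f df 0 h h0) as [c [Ec Hc]].
  { intros x Hx. apply is_derive_Reals, H1. lra. }
  specialize (P2 h ltac:(lra)). rewrite Rabs_pos_eq in P2 by lra.
  specialize (P2 hd2). rewrite Rplus_0_l, Z, Rminus_0_r in P2.
  replace ((f h - f 0) / h) with (df c) in P2 by (rewrite Ec; field; lra).
  specialize (P1 c). rewrite Rminus_0_r, Q0, Rminus_0_r, (Rabs_pos_eq c) in P1 by lra.
  specialize (P1 ltac:(lra)).
  replace (J s) with (J c).
  2:{ apply derive_zero_const. intros x Hx. apply HJ.
      rewrite Rmin_left in Hx by lra. lra. }
  unfold J. apply Rle_lt_trans with (1 := Rabs_triang _ _).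
  rewrite !Rabs_mult, (Rabs_pos_eq K), (Rabs_pos_eq c) by lra.
  assert (K * c < e / 2).
  { apply Rlt_le_trans with (K * (e / (2 * K))).
    - apply Rmult_lt_compat_l; lra.
    - right. field. lra. }
  assert (0 <= K * c) by (apply Rmult_le_pos; lra).
  generalize (Rabs_pos (df c)). nra.
Qed.

(** The derivative of f(sqrt z) at 0 is not directly accessible, so [F] is obtained by integrating
    the derivative that the first integral prescribes, and is then matched with [f] on squares. *)
Lemma profile_smooth (K lambda : R) (f df d2f : R -> R) :
  0 < K ->
  (forall s, 0 <= s -> is_derive f s (df s)) ->
  (forall s, 0 < s -> is_derive df s (d2f s)) ->
  (forall s, 0 < s -> d2f s + df s / s + 2 * PI / K * exp (f s) = 2 * lambda / K) ->
  df 0 = 0 ->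
  exists F dF A dA : R -> R,
    (forall z, is_derive F z (dF z)) /\ (forall z, continuous dF z) /\
    (forall z, is_derive A z (dA z)) /\ (forall z, continuous dA z) /\
    (forall s, 0 <= s -> F (s ^ 2) = f s) /\
    (forall z, 0 <= z -> 2 * K * dF z + PI * A z = lambda) /\
    (forall z, A z + z * dA z = exp (F z)).
Proof.
  intros K0 H1 H2 ode Z.
  (* For z < 0 the square root is 0, so [E0] continues as the constant e^(f 0) and is continuous on
     the whole line. *)
  set (E0 := fun z => exp (f (sqrt z))).
  assert (cE0 : forall z, continuous E0 z).
  { intros z. unfold E0. apply (continuous_comp (fun z => f (sqrt z)) exp).
    - apply (continuous_comp sqrt f); [apply continuous_sqrt|].
      eapply is_derive_continuous. apply H1. apply sqrt_pos.
    - eapply is_derive_continuous. apply is_derive_exp. }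
  assert (int := profile_first_integral K lambda f df d2f K0 H1 H2 ode Z cE0).
  fold E0 in int.
  set (dF := fun z => (lambda - PI * avg E0 z) / (2 * K)).
  assert (cdF : forall z, continuous dF z).
  { intros z. apply (continuous_comp (avg E0) (fun v => (lambda - PI * v) / (2 * K))).
    - now apply avg_continuous.
    - apply (is_derive_continuous _ _ (- PI / (2 * K))). auto_derive; auto. field. lra. }
  set (F := fun z => f 0 + RInt dF 0 z).
  assert (HF : forall z, is_derive F z (dF z)).
  { intros z. unfold F. replace (dF z) with (0 + dF z) by ring.
    apply (is_derive_plus (V := R_NormedModule)).
    - apply (is_derive_const (V := R_NormedModule)).
    - now apply is_derive_RInt_continuous. }
  assert (F0 : F 0 = f 0) by (unfold F; rewrite RInt_point_0; ring).
  assert (Ff : forall s, 0 <= s -> F (s ^ 2) = f s).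
  { intros s s0. apply Rminus_diag_uniq.
    transitivity (F (0 ^ 2) - f 0).
    2:{ replace (0 ^ 2) with 0 by ring. rewrite F0. ring. }
    symmetry. apply (derive_zero_const (fun x => F (x ^ 2) - f x)).
    intros x Hx. rewrite Rmin_left in Hx by auto. auto_derive.
    - repeat split; eexists; [apply HF | apply H1; lra].
    - rewrite (is_derive_unique (fun x : R => F x) _ _ (HF _)),
        (is_derive_unique (fun x : R => f x) _ _ (H1 x ltac:(lra))).
      replace (x * (x * 1)) with (x ^ 2) by ring.
      destruct (Req_dec x 0) as [-> | nx]; [rewrite Z; ring|].
      specialize (int x ltac:(lra)). rewrite <- mult_avg in int.
      replace (df x) with ((lambda * x ^ 2 - PI * (x ^ 2 * avg E0 (x ^ 2))) / (K * x))
        by (rewrite <- int; field; lra).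
      unfold dF. field. lra. }
  (* [E0] is only known to be continuous, so [A] averages the differentiable [E] instead. The two
     agree for z >= 0 but may differ for z < 0, hence the restriction to 0 <= z in the first
     integral. *)
  set (E := fun z => exp (F z)). set (dE := fun z => dF z * exp (F z)).
  assert (HE : forall z, is_derive E z (dE z)).
  { intros z. unfold E, dE. auto_derive.
    - eexists. apply HF.
    - rewrite (is_derive_unique (fun x : R => F x) _ _ (HF z)). ring. }
  assert (cdE : forall z, continuous dE z).
  { intros z. apply (continuous_mult (K := R_AbsRing) dF E); auto.
    eapply is_derive_continuous. apply HE. }
  exists F, dF, (avg E), (davg E dE).
  split; [|split; [|split; [|split; [|split; [|split]]]]]; auto.
  - intros z. now apply is_derive_avg.
  - intros z. now apply davg_continuous.
  - intros z z0. replace (avg E z) with (avg E0 z); [unfold dF; field; lra|].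
    assert (EE : forall w, 0 <= w -> E0 w = E w).
    { intros w w0. unfold E0, E. rewrite <- Ff by apply sqrt_pos.
      now rewrite pow2_sqrt. }
    unfold avg. destruct (Req_EM_T z 0); [apply EE; lra|].
    f_equal. apply RInt_ext. intros w Hw. apply EE. rewrite Rmin_left in Hw; lra.
  - intros z. unfold davg. destruct (Req_EM_T z 0) as [-> | nz].
    + rewrite avg_0. unfold E. ring.
    + unfold E. field. auto.
Qed.

(** * Continuously differentiable functions of (t, x, y) *)

Definition cont3 (g : F3) : Prop := forall p : R * (R * R),
  continuous (fun p : R * (R * R) => g (fst p) (fst (snd p)) (snd (snd p))) p.

(** Explicit derivatives, continuous for all real [t], make the class closed under sums, products
    and composition by the usual formulas; it implies [C1_half], where the derivatives are chosen
    limits. *)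
Definition C1 (g : F3) : Prop := exists gt gx gy : F3,
  (forall t x y, has_pt g t x y (gt t x y)) /\ (forall t x y, has_px g t x y (gx t x y)) /\
  (forall t x y, has_py g t x y (gy t x y)) /\
  cont3 g /\ cont3 gt /\ cont3 gx /\ cont3 gy.

Lemma cont3_const (c : R) : cont3 (fun _ _ _ => c).
Proof. intros p. apply continuous_const. Qed.

Lemma cont3_plus (g h : F3) :
  cont3 g -> cont3 h -> cont3 (fun t x y => g t x y + h t x y).
Proof. intros Hg Hh p. apply (continuous_plus (V := R_NormedModule)); [apply Hg | apply Hh]. Qed.

Lemma cont3_mult (g h : F3) :
  cont3 g -> cont3 h -> cont3 (fun t x y => g t x y * h t x y).
Proof. intros Hg Hh p. apply (continuous_mult (K := R_AbsRing)); [apply Hg | apply Hh]. Qed.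

Lemma cont3_comp (phi : R -> R) (g : F3) :
  (forall z, continuous phi z) -> cont3 g -> cont3 (fun t x y => phi (g t x y)).
Proof.
  intros Hphi Hg p.
  apply (continuous_comp (fun p : R * (R * R) => g (fst p) (fst (snd p)) (snd (snd p))) phi).
  - apply Hg.
  - apply Hphi.
Qed.

Lemma C1_const (c : R) : C1 (fun _ _ _ => c).
Proof.
  exists (fun _ _ _ => 0), (fun _ _ _ => 0), (fun _ _ _ => 0).
  repeat apply conj; try apply cont3_const; intros; apply derivable_pt_lim_const.
Qed.

Lemma C1_t : C1 (fun t _ _ => t).
Proof.
  exists (fun _ _ _ => 1), (fun _ _ _ => 0), (fun _ _ _ => 0).
  repeat apply conj; try apply cont3_const; try (intros; apply derivable_pt_lim_const).
  - intros. apply derivable_pt_lim_id.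
  - intros p. apply continuous_fst.
Qed.

Lemma C1_x : C1 (fun _ x _ => x).
Proof.
  exists (fun _ _ _ => 0), (fun _ _ _ => 1), (fun _ _ _ => 0).
  repeat apply conj; try apply cont3_const; try (intros; apply derivable_pt_lim_const).
  - intros. apply derivable_pt_lim_id.
  - intros p. apply (continuous_comp snd fst); [apply continuous_snd | apply continuous_fst].
Qed.

Lemma C1_y : C1 (fun _ _ y => y).
Proof.
  exists (fun _ _ _ => 0), (fun _ _ _ => 0), (fun _ _ _ => 1).
  repeat apply conj; try apply cont3_const; try (intros; apply derivable_pt_lim_const).
  - intros. apply derivable_pt_lim_id.
  - intros p. apply (continuous_comp snd snd); apply continuous_snd.
Qed.

Lemma C1_plus (g h : F3) : C1 g -> C1 h -> C1 (fun t x y => g t x y + h t x y).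
Proof.
  intros [gt [gx [gy [Gt [Gx [Gy [cg [cgt [cgx cgy]]]]]]]]]
    [ht [hx [hy [Ht [Hx [Hy [ch [cht [chx chy]]]]]]]]].
  exists (fun t x y => gt t x y + ht t x y), (fun t x y => gx t x y + hx t x y),
    (fun t x y => gy t x y + hy t x y).
  repeat apply conj; try (now apply cont3_plus); intros t x y.
  - exact (derivable_pt_lim_plus _ _ _ _ _ (Gt t x y) (Ht t x y)).
  - exact (derivable_pt_lim_plus _ _ _ _ _ (Gx t x y) (Hx t x y)).
  - exact (derivable_pt_lim_plus _ _ _ _ _ (Gy t x y) (Hy t x y)).
Qed.

Lemma C1_mult (g h : F3) : C1 g -> C1 h -> C1 (fun t x y => g t x y * h t x y).
Proof.
  intros [gt [gx [gy [Gt [Gx [Gy [cg [cgt [cgx cgy]]]]]]]]]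
    [ht [hx [hy [Ht [Hx [Hy [ch [cht [chx chy]]]]]]]]].
  exists (fun t x y => gt t x y * h t x y + g t x y * ht t x y),
    (fun t x y => gx t x y * h t x y + g t x y * hx t x y),
    (fun t x y => gy t x y * h t x y + g t x y * hy t x y).
  repeat apply conj; try (now apply cont3_mult);
    try (now apply cont3_plus; apply cont3_mult); intros t x y.
  - exact (derivable_pt_lim_mult _ _ _ _ _ (Gt t x y) (Ht t x y)).
  - exact (derivable_pt_lim_mult _ _ _ _ _ (Gx t x y) (Hx t x y)).
  - exact (derivable_pt_lim_mult _ _ _ _ _ (Gy t x y) (Hy t x y)).
Qed.

Lemma C1_comp (phi dphi : R -> R) (g : F3) :
  (forall z, is_derive phi z (dphi z)) -> (forall z, continuous dphi z) ->
  C1 g -> C1 (fun t x y => phi (g t x y)).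
Proof.
  intros D cd [gt [gx [gy [Gt [Gx [Gy [cg [cgt [cgx cgy]]]]]]]]].
  assert (D' : forall z, derivable_pt_lim phi z (dphi z)) by (intros z; apply is_derive_Reals, D).
  assert (cphi : forall z, continuous phi z)
    by (intros z; eapply is_derive_continuous; apply D).
  exists (fun t x y => dphi (g t x y) * gt t x y), (fun t x y => dphi (g t x y) * gx t x y),
    (fun t x y => dphi (g t x y) * gy t x y).
  repeat apply conj; try (now apply cont3_comp);
    try (apply cont3_mult; auto; now apply cont3_comp); intros t x y.
  - exact (derivable_pt_lim_comp _ phi _ _ _ (Gt t x y) (D' _)).
  - exact (derivable_pt_lim_comp _ phi _ _ _ (Gx t x y) (D' _)).
  - exact (derivable_pt_lim_comp _ phi _ _ _ (Gy t x y) (D' _)).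
Qed.

Lemma choose_lim_eq (P : R -> Prop) (l : R) :
  P l -> (forall k, P k -> k = l) -> choose_lim P = l.
Proof.
  intros Hl U. unfold choose_lim.
  destruct (ClassicalEpsilon.excluded_middle_informative (exists l, P l)) as [H | H].
  - apply U. exact (proj2_sig (ClassicalEpsilon.constructive_indefinite_description _ H)).
  - exfalso. apply H. now exists l.
Qed.

Lemma Dt_eq (g : F3) (t x y l : R) : has_pt g t x y l -> Defs.Dt g t x y = l.
Proof. intros H. apply choose_lim_eq; auto. intros k Hk. exact (uniqueness_limite _ _ _ _ Hk H). Qed.

Lemma Dx_eq (g : F3) (t x y l : R) : has_px g t x y l -> Defs.Dx g t x y = l.
Proof. intros H. apply choose_lim_eq; auto. intros k Hk. exact (uniqueness_limite _ _ _ _ Hk H). Qed.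

Lemma Dy_eq (g : F3) (t x y l : R) : has_py g t x y l -> Defs.Dy g t x y = l.
Proof. intros H. apply choose_lim_eq; auto. intros k Hk. exact (uniqueness_limite _ _ _ _ Hk H). Qed.

Lemma cont3_half (g h : F3) :
  (forall t x y, h t x y = g t x y) -> cont3 g -> cont_on_half h.
Proof.
  intros E H t x y _ e He.
  destruct (proj1 (filterlim_locally (F := locally (t, (x, y))) _ _) (H (t, (x, y)))
    (mkposreal e He)) as [d Hd].
  exists d. split; [apply cond_pos|]. intros t' x' y' _ Ht Hx Hy. rewrite !E.
  apply (Hd (t', (x', y'))). split; [exact Ht | split; [exact Hx | exact Hy]].
Qed.

Lemma C1_C1_half (g : F3) : C1 g -> C1_half g.
Proof.
  intros [gt [gx [gy [Gt [Gx [Gy [cg [cgt [cgx cgy]]]]]]]]].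
  split; [|split; [|split; [|split]]].
  - intros t x y _. split; [|split]; eexists; [apply Gt | apply Gx | apply Gy].
  - now apply cont3_half with g.
  - apply cont3_half with gt; auto. intros. now apply Dt_eq.
  - apply cont3_half with gx; auto. intros. now apply Dx_eq.
  - apply cont3_half with gy; auto. intros. now apply Dy_eq.
Qed.

Lemma C1_time (phi dphi : R -> R) :
  (forall t, is_derive phi t (dphi t)) -> (forall t, continuous dphi t) ->
  C1 (fun t _ _ => phi t).
Proof. intros D cd. exact (C1_comp phi dphi _ D cd C1_t). Qed.

Lemma C1_ext (g h : F3) : (forall t x y, g t x y = h t x y) -> C1 g -> C1 h.
Proof.
  intros E H. replace h with g; auto.
  do 3 (apply functional_extensionality; intros). apply E.
Qed.

(** * The rotating self-similar flow *)

(** The angular velocity xi/a^2 conserves angular momentum, so the tangential acceleration cancels;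
    its centripetal part cancels the term xi^2/a^3 of a''. What remains of the acceleration is -
    lambda x / a^2, and balancing it with pressure and gravity is the first integral 2 K F' + pi A =
    lambda. *)
Lemma self_similar_classical_solution (K lambda xi : R) (F dF A dA a da : R -> R) :
  (forall z, is_derive F z (dF z)) -> (forall z, continuous dF z) ->
  (forall z, is_derive A z (dA z)) -> (forall z, continuous dA z) ->
  (forall z, 0 <= z -> 2 * K * dF z + PI * A z = lambda) ->
  (forall z, A z + z * dA z = exp (F z)) ->
  (forall t, 0 < a t) -> (forall t, is_derive a t (da t)) ->
  (forall t, is_derive da t (force lambda xi (a t))) ->
  EP_classical_solution K (fun t x y => exp (F ((x ^ 2 + y ^ 2) / a t ^ 2)) / a t ^ 2)
    (u1_of xi a da) (u2_of xi a da)
    (fun t x y => PI * x / a t ^ 2 * A ((x ^ 2 + y ^ 2) / a t ^ 2))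
    (fun t x y => PI * y / a t ^ 2 * A ((x ^ 2 + y ^ 2) / a t ^ 2)).
Proof.
  intros HF cdF HA cdA KF EA a_pos Ha Hda.
  assert (ca : forall t, continuous a t) by (intros t; eapply is_derive_continuous; apply Ha).
  assert (cda : forall t, continuous da t) by (intros t; eapply is_derive_continuous; apply Hda).
  assert (Hia : forall t, is_derive (fun t => / a t) t (- (da t * (/ a t * / a t)))).
  { intros t. specialize (a_pos t). auto_derive.
    - split; [now exists (da t) | lra].
    - rewrite (is_derive_unique (fun x : R => a x) _ _ (Ha t)). field. lra. }
  assert (cia : forall t, continuous (fun t => / a t) t)
    by (intros t; eapply is_derive_continuous; apply Hia).
  assert (cmul : forall (g h : R -> R) t, continuous g t -> continuous h t ->
            continuous (fun t => g t * h t) t).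
  { intros g h t. apply (continuous_mult (K := R_AbsRing)). }
  assert (Cia : C1 (fun t _ _ => / a t)).
  { apply C1_time with (1 := Hia). intros t.
    apply (continuous_opp (V := R_NormedModule) (fun t => da t * (/ a t * / a t))).
    apply cmul; auto. }
  assert (Cda : C1 (fun t _ _ => da t)).
  { apply C1_time with (1 := Hda). intros t.
    apply (continuous_comp a (force lambda xi)); auto.
    eapply is_derive_continuous. now apply is_derive_force. }
  assert (Cia2 : C1 (fun t _ _ => / a t ^ 2)).
  { apply C1_ext with (2 := C1_mult _ _ Cia Cia). intros t x y. specialize (a_pos t).
    field. lra. }
  assert (Cz : C1 (fun t x y => (x ^ 2 + y ^ 2) / a t ^ 2)).
  { apply C1_ext with (2 := C1_mult _ _
      (C1_plus _ _ (C1_mult _ _ C1_x C1_x) (C1_mult _ _ C1_y C1_y)) Cia2).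
    intros t x y. unfold Rdiv. ring. }
  assert (Crho : C1 (fun t x y => exp (F ((x ^ 2 + y ^ 2) / a t ^ 2)) / a t ^ 2)).
  { apply (C1_mult (fun t x y => exp (F ((x ^ 2 + y ^ 2) / a t ^ 2))) (fun t _ _ => / a t ^ 2));
      auto.
    apply (C1_comp exp exp (fun t x y => F ((x ^ 2 + y ^ 2) / a t ^ 2))).
    - apply is_derive_exp.
    - intros z. eapply is_derive_continuous. apply is_derive_exp.
    - now apply (C1_comp F dF (fun t x y => (x ^ 2 + y ^ 2) / a t ^ 2)). }
  assert (Cu1 : C1 (u1_of xi a da)).
  { apply C1_ext with (2 := C1_plus _ _ (C1_mult _ _ (C1_mult _ _ Cda Cia) C1_x)
      (C1_mult _ _ (C1_mult _ _ (C1_const (- xi)) Cia2) C1_y)).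
    intros t x y. unfold u1_of, Rdiv. ring. }
  assert (Cu2 : C1 (u2_of xi a da)).
  { apply C1_ext with (2 := C1_plus _ _ (C1_mult _ _ (C1_mult _ _ (C1_const xi) Cia2) C1_x)
      (C1_mult _ _ (C1_mult _ _ Cda Cia) C1_y)).
    intros t x y. unfold u2_of, Rdiv. ring. }
  assert (CA := C1_comp A dA _ HA cdA Cz).
  assert (CG1 : C1 (fun t x y => PI * x / a t ^ 2 * A ((x ^ 2 + y ^ 2) / a t ^ 2))).
  { apply (C1_mult (fun t x y => PI * x / a t ^ 2)); auto.
    apply (C1_mult (fun t x y => PI * x)); auto.
    exact (C1_mult _ _ (C1_const PI) C1_x). }
  assert (CG2 : C1 (fun t x y => PI * y / a t ^ 2 * A ((x ^ 2 + y ^ 2) / a t ^ 2))).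
  { apply (C1_mult (fun t x y => PI * y / a t ^ 2)); auto.
    apply (C1_mult (fun t x y => PI * y)); auto.
    exact (C1_mult _ _ (C1_const PI) C1_y). }
  do 7 (split; [apply C1_C1_half; auto using C1_mult|]).
  intros t x y _. assert (at0 := a_pos t).
  set (rho := fun t x y => exp (F ((x ^ 2 + y ^ 2) / a t ^ 2)) / a t ^ 2).
  set (z := (x ^ 2 + y ^ 2) / a t ^ 2).
  assert (a2 := pow_lt (a t) 2 at0).
  assert (z0 : 0 <= z).
  { unfold z. apply Rdiv_le_0_compat; auto.
    generalize (pow2_ge_0 x) (pow2_ge_0 y). lra. }
  assert (UF : Derive (fun x : R => F x) z = dF z) by exact (is_derive_unique _ _ _ (HF z)).
  assert (UA : Derive (fun x : R => A x) z = dA z) by exact (is_derive_unique _ _ _ (HA z)).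
  assert (Ua : Derive (fun x : R => a x) t = da t) by exact (is_derive_unique _ _ _ (Ha t)).
  assert (Uda : Derive (fun x : R => da x) t = force lambda xi (a t))
    by exact (is_derive_unique _ _ _ (Hda t)).
  assert (exF : forall z, ex_derive (fun x : R => F x) z) by (intros w; now exists (dF w)).
  assert (exA : forall z, ex_derive (fun x : R => A x) z) by (intros w; now exists (dA w)).
  assert (exa : ex_derive (fun x : R => a x) t) by now exists (da t).
  assert (exda : ex_derive (fun x : R => da x) t) by (eexists; apply Hda).
  assert (a2' : a t * (a t * 1) <> 0) by (simpl in a2; lra).
  assert (zE : (x * (x * 1) + y * (y * 1)) * / (a t * (a t * 1)) = z) by reflexivity.
  assert (rho_t : has_pt rho t x y (rho t x y * (- 2 * da t / a t) * (1 + z * dF z))).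
  { apply is_derive_Reals. unfold rho. auto_derive.
    - repeat split; auto.
    - rewrite zE, UF, Ua. fold z. generalize (exp (F z)) (dF z). intros e d.
      unfold z. field. lra. }
  assert (rho_x : has_px rho t x y (rho t x y * dF z * (2 * x / a t ^ 2))).
  { apply is_derive_Reals. unfold rho. auto_derive.
    - repeat split; auto.
    - rewrite zE, UF. fold z. field. lra. }
  assert (rho_y : has_py rho t x y (rho t x y * dF z * (2 * y / a t ^ 2))).
  { apply is_derive_Reals. unfold rho. auto_derive.
    - repeat split; auto.
    - rewrite zE, UF. fold z. field. lra. }
  assert (u1_t : has_pt (u1_of xi a da) t x y
    ((force lambda xi (a t) / a t - da t ^ 2 / a t ^ 2) * x + 2 * xi * da t / a t ^ 3 * y)).
  { apply is_derive_Reals. unfold u1_of. auto_derive.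
    - repeat split; auto; lra.
    - rewrite Ua, Uda. field. lra. }
  assert (u1_x : has_px (u1_of xi a da) t x y (da t / a t)).
  { apply is_derive_Reals. unfold u1_of. auto_derive; auto. ring. }
  assert (u1_y : has_py (u1_of xi a da) t x y (- xi / a t ^ 2)).
  { apply is_derive_Reals. unfold u1_of. auto_derive; auto. field. lra. }
  assert (u2_t : has_pt (u2_of xi a da) t x y
    ((force lambda xi (a t) / a t - da t ^ 2 / a t ^ 2) * y - 2 * xi * da t / a t ^ 3 * x)).
  { apply is_derive_Reals. unfold u2_of. auto_derive.
    - repeat split; auto; lra.
    - rewrite Ua, Uda. field. lra. }
  assert (u2_x : has_px (u2_of xi a da) t x y (xi / a t ^ 2)).
  { apply is_derive_Reals. unfold u2_of. auto_derive; auto. field. lra. }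
  assert (u2_y : has_py (u2_of xi a da) t x y (da t / a t)).
  { apply is_derive_Reals. unfold u2_of. auto_derive; auto. ring. }
  assert (G1_x : has_px (fun t x y => PI * x / a t ^ 2 * A ((x ^ 2 + y ^ 2) / a t ^ 2)) t x y
    (PI / a t ^ 2 * (A z + 2 * x ^ 2 / a t ^ 2 * dA z))).
  { apply is_derive_Reals. auto_derive.
    - repeat split; auto.
    - rewrite zE, UA. field. lra. }
  assert (G2_y : has_py (fun t x y => PI * y / a t ^ 2 * A ((x ^ 2 + y ^ 2) / a t ^ 2)) t x y
    (PI / a t ^ 2 * (A z + 2 * y ^ 2 / a t ^ 2 * dA z))).
  { apply is_derive_Reals. auto_derive.
    - repeat split; auto.
    - rewrite zE, UA. field. lra. }
  assert (lam : lambda = 2 * K * dF z + PI * A z) by (symmetry; now apply KF).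
  rewrite (Dt_eq _ _ _ _ _ rho_t), (Dt_eq _ _ _ _ _ u1_t), (Dx_eq _ _ _ _ _ u1_x),
    (Dy_eq _ _ _ _ _ u1_y), (Dt_eq _ _ _ _ _ u2_t), (Dx_eq _ _ _ _ _ u2_x),
    (Dy_eq _ _ _ _ _ u2_y), (Dx_eq _ _ _ _ _ G1_x), (Dy_eq _ _ _ _ _ G2_y).
  rewrite (Dx_eq _ _ _ _ _ (derivable_pt_lim_mult _ _ _ _ _ rho_x u1_x)),
    (Dy_eq _ _ _ _ _ (derivable_pt_lim_mult _ _ _ _ _ rho_y u2_y)),
    (Dx_eq _ _ _ _ _ (derivable_pt_lim_scal _ K _ _ rho_x)),
    (Dy_eq _ _ _ _ _ (derivable_pt_lim_scal _ K _ _ rho_y)).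
  fold z. repeat apply conj.
  (* With e^F and F' as free variables: a density of the form g(x/a)/a^2 with radial g is carried by
     this flow whatever the profile. *)
  - change (rho t x y) with (exp (F z) / a t ^ 2).
    generalize (exp (F z)) (dF z). intros e d. unfold u1_of, u2_of, z. field. lra.
  - change (rho t x y) with (exp (F z) / a t ^ 2). unfold force, u1_of, u2_of.
    rewrite lam. field. lra.
  - change (rho t x y) with (exp (F z) / a t ^ 2). unfold force, u1_of, u2_of.
    rewrite lam. field. lra.
  (* The divergence is 2 pi (A + z A') / a^2, and A + z A' = e^F. *)
  - rewrite <- EA. generalize (A z) (dA z). intros e d. unfold z. field. lra.
Qed.

Lemma Defs_RInt_eq (g : R -> R) (a b l : R) : is_RInt g a b l -> Defs.RInt g a b = l.
Proof.
  intros H. unfold Defs.RInt.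
  destruct (ClassicalEpsilon.excluded_middle_informative _) as [i | n].
  - rewrite <- RInt_Reals. now apply (is_RInt_unique (V := R_CompleteNormedModule)).
  - exfalso. apply n. constructor. apply ex_RInt_Reals_0. now exists l.
Qed.

Lemma rad_pos (x y : R) : 0 <= rad x y.
Proof. apply sqrt_pos. Qed.

Lemma rad_sqr (x y : R) : rad x y ^ 2 = x ^ 2 + y ^ 2.
Proof.
  apply pow2_sqrt. generalize (pow2_ge_0 x) (pow2_ge_0 y). lra.
Qed.

Lemma rad_0 (x y : R) : rad x y = 0 -> x = 0 /\ y = 0.
Proof.
  intros H. assert (E := rad_sqr x y). rewrite H in E.
  generalize (pow2_ge_0 x) (pow2_ge_0 y). intros.
  split; apply Rsqr_0_uniq; rewrite Rsqr_pow2; lra.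
Qed.

Lemma rho_rad_eq (f F a : R -> R) (t r : R) :
  (forall s, 0 <= s -> F (s ^ 2) = f s) -> 0 < a t -> 0 <= r ->
  rho_rad f a t r = exp (F (r ^ 2 / a t ^ 2)) / a t ^ 2.
Proof.
  intros Ff at0 r0. unfold rho_rad. rewrite <- Ff by now apply Rdiv_le_0_compat.
  do 3 f_equal. field. lra.
Qed.

(** With z = s^2/a^2, the function z A(z)/2 of s is an antiderivative of the integrand, because (z
    A)' = e^F. *)
Lemma Phir_of_eq (f F A dA a : R -> R) (t r : R) :
  (forall s, 0 <= s -> F (s ^ 2) = f s) -> (forall z, continuous F z) ->
  (forall z, is_derive A z (dA z)) -> (forall z, A z + z * dA z = exp (F z)) ->
  0 < a t -> 0 < r -> Phir_of f a t r = PI * r / a t ^ 2 * A (r ^ 2 / a t ^ 2).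
Proof.
  intros Ff cF HA EA at0 r0. unfold Phir_of.
  rewrite (Defs_RInt_eq _ _ _ (r ^ 2 / a t ^ 2 * A (r ^ 2 / a t ^ 2) / 2)).
  { field. lra. }
  set (I := fun s => s ^ 2 / a t ^ 2 * A (s ^ 2 / a t ^ 2) / 2).
  set (dI := fun s => exp (F (s ^ 2 / a t ^ 2)) / a t ^ 2 * s).
  apply (is_RInt_ext (V := R_NormedModule) dI).
  - intros s Hs. rewrite Rmin_left, Rmax_right in Hs by lra.
    rewrite (rho_rad_eq f F a); auto. lra.
  - assert (I0 : I 0 = 0) by (unfold I; replace (0 ^ 2) with 0 by ring; field; lra).
    replace (r ^ 2 / a t ^ 2 * A (r ^ 2 / a t ^ 2) / 2) with (minus (I r) (I 0)).
    2:{ rewrite I0. change (I r - 0 = I r). ring. }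
    apply (is_RInt_derive (V := R_CompleteNormedModule) I dI).
    + intros s _. unfold I, dI. rewrite <- EA. auto_derive.
      * eexists. apply HA.
      * change (s * (s * 1) * / (a t * (a t * 1))) with (s ^ 2 / a t ^ 2).
        rewrite (is_derive_unique (fun x : R => A x) _ _ (HA _)).
        generalize (A (s ^ 2 / a t ^ 2)) (dA (s ^ 2 / a t ^ 2)). intros u v. field. lra.
    + intros s _. unfold dI.
      assert (cz : forall c, continuous (fun s => s ^ 2 / c) s).
      { intros c. apply (is_derive_continuous _ _ (2 * s / c)). auto_derive; auto.
        unfold Rdiv. ring. }
      apply (continuous_mult (K := R_AbsRing) (fun s => exp (F (s ^ 2 / a t ^ 2)) / a t ^ 2)
        (fun s => s)); [|apply continuous_id].
      apply (continuous_mult (K := R_AbsRing) (fun s => exp (F (s ^ 2 / a t ^ 2)))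
        (fun _ => / a t ^ 2)); [|apply continuous_const].
      apply (continuous_comp (fun s => F (s ^ 2 / a t ^ 2)) exp).
      * apply (continuous_comp (fun s => s ^ 2 / a t ^ 2) F); auto.
      * eapply is_derive_continuous. apply is_derive_exp.
Qed.

Theorem theorem1 :
  forall (K xi lambda a0 a1 alpha : R) (f df d2f : R -> R),
    0 < K -> xi <> 0 -> 0 < a0 ->
    (* f solves f'' + f'/s + (2 pi/K) e^f = 2 lambda/K on s > 0, f(0)=alpha, f'(0)=0 *)
    (forall s, 0 <= s -> derivable_pt_lim f s (df s)) ->
    (forall s, 0 < s -> derivable_pt_lim df s (d2f s)) ->
    (forall s, 0 < s ->
       d2f s + df s / s + 2 * PI / K * exp (f s) = 2 * lambda / K) ->
    f 0 = alpha -> df 0 = 0 ->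
    exists a da : R -> R,
      (* a solves a'' = -lambda/a + xi^2/a^3, a(0)=a0, a'(0)=a1, and a > 0 for t >= 0 *)
      (forall t, derivable_pt_lim a t (da t)) /\
      (forall t, 0 <= t -> derivable_pt_lim da t (- lambda / a t + xi ^ 2 / (a t) ^ 3)) /\
      a 0 = a0 /\ da 0 = a1 /\
      (forall t, 0 <= t -> 0 < a t) /\
      (* (rho, u, Phi) is a classical solution for all t >= 0 *)
      EP_classical_solution K (rho_of f a) (u1_of xi a da) (u2_of xi a da)
        (G1_of f a) (G2_of f a) /\
      (* (I)(a): non-trivially time-periodic *)
      (0 < lambda -> ~ (a0 = Rabs xi / sqrt lambda /\ a1 = 0) ->
        (exists T, 0 < T /\ forall t x y, 0 <= t ->
            rho_of f a (t + T) x y = rho_of f a t x y /\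
            u1_of xi a da (t + T) x y = u1_of xi a da t x y /\
            u2_of xi a da (t + T) x y = u2_of xi a da t x y) /\
        (exists t x y, 0 <= t /\
            (rho_of f a t x y <> rho_of f a 0 x y \/
             u1_of xi a da t x y <> u1_of xi a da 0 x y \/
             u2_of xi a da t x y <> u2_of xi a da 0 x y))) /\
      (* (I)(b): steady *)
      (0 < lambda -> a0 = Rabs xi / sqrt lambda -> a1 = 0 ->
        forall t x y, 0 <= t ->
            rho_of f a t x y = rho_of f a 0 x y /\
            u1_of xi a da t x y = u1_of xi a da 0 x y /\
            u2_of xi a da t x y = u2_of xi a da 0 x y) /\
      (* (II): global in time *)
      (lambda <= 0 -> forall t, 0 <= t -> 0 < a t).
Proof.
  intros K xi lambda a0 a1 alpha f df d2f K0 xi0 a0_pos H1 H2 ode _ Z.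
  assert (H1' : forall s, 0 <= s -> is_derive f s (df s))
    by (intros s Hs; now apply is_derive_Reals, H1).
  assert (H2' : forall s, 0 < s -> is_derive df s (d2f s))
    by (intros s Hs; now apply is_derive_Reals, H2).
  destruct (profile_smooth K lambda f df d2f K0 H1' H2' ode Z)
    as [F [dF [A [dA [HF [cdF [HA [cdA [Ff [KF EA]]]]]]]]]].
  assert (cF : forall z, continuous F z) by (intros z; eapply is_derive_continuous; apply HF).
  destruct (scale_solution_exists lambda xi a0 a1 xi0 a0_pos)
    as [m [a [da [S [E0 [E1 En]]]]]].
  assert (S' := S). destruct S' as [m0 [am [Ha Hda]]].
  assert (a_pos : forall t, 0 < a t) by (intros t; specialize (am t); lra).
  exists a, da.
  split; [|split; [|split; [|split; [|split; [|split; [|split; [|split]]]]]]]; auto.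
  - intros t. apply is_derive_Reals, Ha.
  - intros t _. apply is_derive_Reals, Hda.
  - assert (Er : rho_of f a = fun t x y => exp (F ((x ^ 2 + y ^ 2) / a t ^ 2)) / a t ^ 2).
    { do 3 (apply functional_extensionality; intros). unfold rho_of.
      rewrite (rho_rad_eq f F); auto using rad_pos. now rewrite rad_sqr. }
    assert (EG : forall t x y, rad x y <> 0 -> Phir_of f a t (rad x y) / rad x y
      = PI / a t ^ 2 * A ((x ^ 2 + y ^ 2) / a t ^ 2)).
    { intros t x y n. assert (p := rad_pos x y).
      rewrite (Phir_of_eq f F A dA) by (auto; lra). rewrite rad_sqr. field.
      split; [apply Rgt_not_eq, a_pos | auto]. }
    (* The formula with [A] also covers the origin, where x = 0 reproduces the value 0 that [G1_of]
       takes there. *)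
    assert (Eg1 : G1_of f a
      = fun t x y => PI * x / a t ^ 2 * A ((x ^ 2 + y ^ 2) / a t ^ 2)).
    { apply functional_extensionality; intros t. apply functional_extensionality; intros x.
      apply functional_extensionality; intros y. unfold G1_of.
      destruct (Req_EM_T (rad x y) 0) as [r0 | n].
      - destruct (rad_0 _ _ r0) as [-> _]. unfold Rdiv. ring.
      - transitivity (x * (Phir_of f a t (rad x y) / rad x y)); [field; auto|].
        rewrite EG by auto. unfold Rdiv. ring. }
    assert (Eg2 : G2_of f a
      = fun t x y => PI * y / a t ^ 2 * A ((x ^ 2 + y ^ 2) / a t ^ 2)).
    { apply functional_extensionality; intros t. apply functional_extensionality; intros x.
      apply functional_extensionality; intros y. unfold G2_of.
      destruct (Req_EM_T (rad x y) 0) as [r0 | n].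
      - destruct (rad_0 _ _ r0) as [_ ->]. unfold Rdiv. ring.
      - transitivity (y * (Phir_of f a t (rad x y) / rad x y)); [field; auto|].
        rewrite EG by auto. unfold Rdiv. ring. }
    rewrite Er, Eg1, Eg2.
    now apply (self_similar_classical_solution K lambda xi F dF A dA a da).
  - intros l0 ne. split.
    + assert (aM := scale_bounded_above lambda xi _ a da l0 a_pos En).
      destruct (scale_periodic lambda xi m _ a da l0 S aM) as [T [T0 HT]].
      exists T. split; auto. intros t x y _. destruct (HT t) as [A1 A2].
      unfold rho_of, rho_rad, u1_of, u2_of. now rewrite A1, A2.
    (* If all fields were constant in time, u2 at (1, 0), which is xi/a^2, would fix a = a0, and
       vanishing velocity and force would give the excluded equilibrium. *)
    + apply NNPP. intros N.
      assert (U : forall t, 0 <= t -> a t = a0).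
      { intros t t0. apply NNPP. intros Na. apply N. exists t, 1, 0. split; auto.
        right. right. unfold u2_of. rewrite !Rmult_0_r, !Rplus_0_r, !Rmult_1_r, E0.
        intros E. apply Na.
        assert (Q : a t ^ 2 = a0 ^ 2).
        { apply Rinv_eq_reg. apply Rmult_eq_reg_l with xi; auto. }
        specialize (a_pos t). apply Rminus_diag_uniq.
        assert (Q' : (a t - a0) * (a t + a0) = 0) by lra.
        apply Rmult_integral in Q'. destruct Q'; lra. }
      assert (Esq : forall t, 0 <= t -> da t ^ 2 = a1 ^ 2).
      { intros t t0. specialize (En t). rewrite (U t t0) in En. lra. }
      (* Constancy is known only for t >= 0 and the energy fixes only da^2, so the mean value
         theorem on [0, 1] is used to find a zero of [da], and later one of the force. *)
      destruct (MVT_le a da 0 1 ltac:(lra)) as [c [Hc Ec]]; auto.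
      rewrite !U in Ec by lra.
      assert (a1_0 : a1 = 0).
      { apply Rsqr_0_uniq. rewrite Rsqr_pow2, <- (Esq c) by lra.
        replace (da c) with 0 by lra. ring. }
      assert (V : forall t, 0 <= t -> da t = 0).
      { intros t t0. apply Rsqr_0_uniq. rewrite Rsqr_pow2, Esq, a1_0 by auto. ring. }
      destruct (MVT_le da (fun t => force lambda xi (a t)) 0 1 ltac:(lra)) as [d [Hd Ed]]; auto.
      rewrite !V, U in Ed by lra.
      apply ne. split; auto. apply (force_zero_iff lambda xi a0); auto. lra.
  - intros l0 Ea Ed t x y _.
    (* The equilibrium is a constant solution above the same [m] with the same data at 0, so
       uniqueness applies. *)
    assert (Sc : scale_solution lambda xi m (fun _ => a0) (fun _ => 0)).
    { split; [|split; [|split]]; auto; intros s.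
      - rewrite <- E0. apply am.
      - apply (is_derive_const (V := R_NormedModule)).
      - rewrite (proj2 (force_zero_iff lambda xi a0 l0 a0_pos) Ea).
        apply (is_derive_const (V := R_NormedModule)). }
    destruct (scale_solution_unique lambda xi m 0 _ _ _ _ S Sc ltac:(auto) ltac:(congruence) t)
      as [At Dat].
    unfold rho_of, rho_rad, u1_of, u2_of. now rewrite At, Dat, E0, E1, Ed.
Qed.
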